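(* Let $r\ge 2$ and let $H$ be a graph with maximum degree $\Delta(H)\ge 2$. There are constants $\eta=\eta(H,r)>0$ and $C=C(H,r)$ such that, if $p=p(n)\ge C n^{-1/m_2(H)}$, then $$\lim_{n\to\infty}\Pr\bigl(\lambda_r(H,G(n,p))\ge \eta\bigr)=1.$$
   Context: $G(n,p)$ is the binomial random graph on $n$ vertices with each edge present independently with probability $p$. For a graph $J$, $d_2(K_2)=1/2$ and $d_2(J)=\frac{e(J)-1}{v(J)-2}$ otherwise; $m_2(H)=\max\{d_2(J):J\subseteq H,\ e(J)\ge1\}$. The $r$-multiplicity $M_r(H,G)$ is the minimum, over all $r$-colourings of the edges of $G$, of the number of monochromatic copies of $H$ in $G$ (so $M_1(H,G)$ is the number of copies of $H$ in $G$), and the Ramsey $r$-robustness is $\lambda_r(H,G)=M_r(H,G)/M_1(H,G)$. *)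

(* Defs.v *)
From HB Require Import structures.
From mathcomp Require Import all_boot all_order all_algebra reals.

Set Implicit Arguments.
Unset Strict Implicit.
Unset Printing Implicit Defensive.

Import Order.TTheory GRing.Theory Num.Theory.
Local Open Scope ring_scope.

Record sgraph (V : finType) := SGraph {
  edges : {set {set V}};
  edgesP : [forall e in edges, #|e| == 2%N]
}.

HB.instance Definition _ (V : finType) := [isSub for @edges V].
HB.instance Definition _ (V : finType) := [Finite of sgraph V by <:].

Definition maxdeg (V : finType) (H : sgraph V) : nat :=
  (\max_(v : V) #|[set e in edges H | v \in e]|)%N.

(* A subgraph, not necessarily spanning, is a pair (vertex set, edge set). *)
Notation vepair V := ({set V} * {set {set V}})%type.

Definition subgraphs (V : finType) (G : sgraph V) : {set vepair V} :=
  [set J : vepair V |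
     (J.2 \subset edges G) && [forall e in J.2, e \subset J.1]].

Definition d2 (R : realType) (V : finType) (J : vepair V) : R :=
  if (#|J.1| == 2%N) && (#|J.2| == 1%N) then 1 / 2
  else (#|J.2|%:R - 1) / (#|J.1|%:R - 2).

(* All the values d2 J with e(J) >= 1 are nonnegative, so the default value 0
   does not affect the maximum as soon as H has an edge. *)
Definition m2 (R : realType) (V : finType) (H : sgraph V) : R :=
  \big[Num.max/0]_(J : vepair V | (J \in subgraphs H) && (1 <= #|J.2|)%N)
     d2 R J.

(* Unlabelled copies: the subgraphs of G isomorphic to H. *)
Definition copies (V W : finType) (H : sgraph V) (G : sgraph W) :
    {set vepair W} :=
  [set J : vepair W in subgraphs G |
     [exists f : {ffun V -> W}, injectiveb f &&
        (J == ([set f x | x : V], [set f @: (e : {set V}) | e in edges H]))]].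

Definition mono_copies (r : nat) (V W : finType) (H : sgraph V) (G : sgraph W)
    (c : {ffun {e : {set W} | e \in edges G} -> 'I_r}) : {set vepair W} :=
  [set J : vepair W in copies H G |
     [exists i : 'I_r, forall e : {e : {set W} | e \in edges G},
        (val e \in J.2) ==> (c e == i)]].

(* No colouring has more than #|copies H G| monochromatic copies, so this
   default value does not affect the minimum as soon as r >= 1. *)
Definition multiplicity (r : nat) (V W : finType) (H : sgraph V)
    (G : sgraph W) : nat :=
  \big[minn/#|copies H G|]_(c : {ffun {e : {set W} | e \in edges G} -> 'I_r})
     #|mono_copies H c|.

(* Equal to 0 when G contains no copy of H. *)
Definition robustness (R : realType) (r : nat) (V W : finType) (H : sgraph V)
    (G : sgraph W) : R :=
  (multiplicity r H G)%:R / (multiplicity 1 H G)%:R.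

Definition Gnp_mass (R : realType) (n : nat) (p : R) (G : sgraph 'I_n) : R :=
  \prod_(e : {set 'I_n} | #|e| == 2%N) (if e \in edges G then p else 1 - p).

Definition Gnp_prob (R : realType) (n : nat) (p : R) (A : pred (sgraph 'I_n))
    : R :=
  \sum_(G : sgraph 'I_n | A G) Gnp_mass p G.

(* Main.v *)
(** A colouring of G(n,p) with few monochromatic copies of H splits the edges
    into classes, each spanning few copies. The hypergraph of copies of H on the
    pairs of vertices has j-degrees O(q^(j-1) n^(v-2)) for every
    q >= n^(-1/m2), so the container method applies with q = theta p, theta a
    small constant: each class I has a fingerprint F(I) of size O(q n^2) inside
    I and lies in a container, determined by F(I), spanning at most eps n^v
    copies. Sparse classes need no special care, because the link hypergraphs
    built by the container algorithm can be followed down to uniformity 0, where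
    their weight bounds the number of copies inside I from below. By Ramsey's
    theorem and averaging, r such containers leave at least delta n^2 pairs
    uncovered, which G(n,p) avoids with probability at most exp(-delta p n^2);
    this beats the number of fingerprints, weighted by p^|F|. Finally the
    total number of copies is at most 2 n^v p^e with high probability, by
    Chebyshev's inequality and the same degree bounds. *)
Require Import Defs.
From mathcomp Require Import all_boot all_order all_algebra.
From mathcomp Require Import ring lra.
From mathcomp Require Import reals sequences exp.

Set Implicit Arguments.
Unset Strict Implicit.
Unset Printing Implicit Defensive.

Import Order.TTheory GRing.Theory Num.Theory.
Local Open Scope ring_scope.

(** * Containers for sparse sets of weighted hypergraphs *)

(** Weights are used instead of set families because several embeddings of [H] can share an edge
    image and a derived link can receive the same set from several elements. Why few copies inside
    [I] force a small container: a pass of the algorithm either produces a still dense weight of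
    uniformity one less, or rejects a fixed proportion of the elements. If every pass produced
    density, a dense weight would reach the empty set; as each pass multiplies the weight inside [I]
    by at most [k], [I] would carry weight of order q^k M N. The obstacle in the union bound is that
    choosing t pairs out of about n^2 costs a logarithm of n per pair. Since the fingerprint lies in
    the graph, a factor p^t is gained, and for every a >= 0 the weighted sum is at most exp(a t + r
    p exp(-a) n^2). With [delta] given, [a] is fixed so that the second term is small against delta
    p n^2, and only then is [theta] chosen so that a t, with t of order theta p n^2, is small too.
    This is why containers are built at density theta p and not p; the price is a factor theta^k in
    [eta]. *)

Section WeightedHypergraphs.
Variables (R : realFieldType) (X : finType).
Implicit Types (w u : {set X} -> R) (A B C I T Z : {set X}) (x : X).

Definition deg w B : R := \sum_(A : {set X} | B \subset A) w A.
Definition mass w C : R := \sum_(A : {set X} | A \subset C) w A.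

Definition weight w := forall A, 0 <= w A.
Definition uniform w (k : nat) C := forall A, w A != 0 -> #|A| = k /\ A \subset C.

Lemma deg_ge0 w B : weight w -> 0 <= deg w B.
Proof. by move=> w0; apply: sumr_ge0. Qed.

Lemma ler_deg w u B : (forall A, w A <= u A) -> deg w B <= deg u B.
Proof. by move=> le_wu; apply: ler_sum. Qed.

Lemma massS w C C' : weight w -> C \subset C' -> mass w C <= mass w C'.
Proof.
move=> w0 sCC'; rewrite /mass [leRHS](bigID (fun A => A \subset C)) /=.
have -> : \sum_(A : {set X} | (A \subset C') && (A \subset C)) w A
          = \sum_(A : {set X} | A \subset C) w A.
  apply: eq_bigl => A; case: (boolP (A \subset C)) => sAC; rewrite ?andbF ?andbT //.
  exact: subset_trans sAC sCC'.
by rewrite lerDl sumr_ge0.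
Qed.

Lemma mass_uniform w k C : uniform w k C -> mass w C = deg w set0.
Proof.
move=> wC; rewrite /mass /deg [RHS](bigID (fun A => A \subset C)) /=.
rewrite [X in _ + X]big1 ?addr0 => [|A /andP[_ nAC]]; last first.
  by apply/eqP/negPn/negP => /wC[_]; rewrite (negbTE nAC).
by apply: eq_bigl => A; rewrite sub0set.
Qed.

Lemma reindex_setU1 x (F : {set X} -> R) :
  \sum_(A : {set X} | x \notin A) F (x |: A) = \sum_(A : {set X} | x \in A) F A.
Proof.
rewrite [RHS](reindex_onto (fun A => x |: A) (fun A => A :\ x)) /=.
  apply: eq_bigl => A; rewrite setU11 /=; apply/idP/eqP.
    by move=> xA; rewrite setU1K.
  by move=> <-; rewrite setD11.
by move=> A xA; rewrite setD1K.
Qed.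

(** Double counting: a set of nonzero weight has 2^k subsets. *)
Lemma sum_deg w k C : uniform w k C ->
  \sum_(B : {set X}) deg w B = 2 ^+ k * deg w set0.
Proof.
move=> wk; rewrite /deg (exchange_big_dep predT) //= mulr_sumr.
apply: eq_big => [A|A _]; first by rewrite sub0set.
rewrite (eq_bigl (mem (powerset A))); last by move=> B; rewrite /= powersetE.
rewrite sumr_const card_powerset.
have [->|/wk[-> _]] := eqVneq (w A) 0; first by rewrite mul0rn mulr0.
by rewrite -[LHS]mulr_natl natrX.
Qed.

(** * One scan: from a weight on (k+1)-sets to a derived weight on k-sets *)

Section OnePass.
Variables (w : {set X} -> R) (D : nat -> R) (theta : R).

(** [D 0] acts as a stopping value: once the empty set is saturated, no set is unsaturated, every
    link vanishes and [u] stays fixed. *)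
Definition saturated u B := D #|B| <= deg u B.
Definition unsaturated u A := [forall B : {set X}, (B \subset A) ==> ~~ saturated u B].
(** Dropping the sets above a saturated one freezes the degree of each [B] as soon as it passes its
    threshold. *)
Definition link u x A := if (x \notin A) && unsaturated u A then w (x |: A) else 0.
Definition contribution u x := \sum_(A : {set X}) link u x A.
Definition heavy u x := theta <= contribution u x.
Definition add_link u x A := u A + link u x A.

(* The decision at x depends on I only through x itself and the elements
   selected before x, so the run can be replayed from the selected set alone. *)
Fixpoint scan I u (s : seq X) : ({set X} -> R) * {set X} * {set X} :=
  if s is x :: s' then
    if heavy u x then
      if x \in I then
        let: (u', T, Z) := scan I (add_link u x) s' in (u', x |: T, Z)
      else let: (u', T, Z) := scan I u s' in (u', T, x |: Z)
    else scan I u s'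
  else (u, set0, set0).

Definition scan_weight I u s := (scan I u s).1.1.
Definition scan_sel I u s := (scan I u s).1.2.
Definition scan_rej I u s := (scan I u s).2.

Lemma scanE I u x s : scan I u (x :: s) =
  if heavy u x then
    if x \in I then (scan_weight I (add_link u x) s,
                     x |: scan_sel I (add_link u x) s, scan_rej I (add_link u x) s)
    else (scan_weight I u s, scan_sel I u s, x |: scan_rej I u s)
  else scan I u s.
Proof.
rewrite /scan_weight /scan_sel /scan_rej /=.
case: ifP => // _; case: ifP => _.
  by case: (scan I (add_link u x) s) => [[]].
by case: (scan I u s) => [[]].
Qed.

Variant scan_spec I u x s : ({set X} -> R) * {set X} * {set X} -> Prop :=
| ScanSel of heavy u x & x \in I :
    scan_spec I u x s (scan_weight I (add_link u x) s,
      x |: scan_sel I (add_link u x) s, scan_rej I (add_link u x) s)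
| ScanRej of heavy u x & x \notin I :
    scan_spec I u x s (scan_weight I u s, scan_sel I u s, x |: scan_rej I u s)
| ScanSkip of ~~ heavy u x :
    scan_spec I u x s (scan_weight I u s, scan_sel I u s, scan_rej I u s).

Lemma scanP I u x s : scan_spec I u x s (scan I u (x :: s)).
Proof.
rewrite scanE; case: ifP => [hx|/negbT hx]; last first.
  by have := ScanSkip I s hx; rewrite /scan_weight /scan_sel /scan_rej; case: (scan I u s) => [[]].
by case: ifP => [xI|/negbT xI]; constructor.
Qed.

Lemma scan_sel_sub I u s : scan_sel I u s \subset I.
Proof.
elim: s u => [|x s IH] u; first by rewrite /scan_sel /= sub0set.
by rewrite /scan_sel; case: (scanP I u x s) => //= _ xI; rewrite subUset sub1set xI IH.
Qed.

Lemma scan_rej_sub I u s : scan_rej I u s \subset ~: I.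
Proof.
elim: s u => [|x s IH] u; first by rewrite /scan_rej /= sub0set.
by rewrite /scan_rej; case: (scanP I u x s) => //= _ xI; rewrite subUset sub1set inE xI IH.
Qed.

Lemma scan_rej_support I u s k C : 0 < theta -> uniform w k C -> scan_rej I u s \subset C.
Proof.
move=> th0 wk; elim: s u => [|x s IH] u; first by rewrite /scan_rej /= sub0set.
rewrite /scan_rej; case: (scanP I u x s) => //= hx _; rewrite subUset sub1set IH andbT.
apply: contraLR hx => xC; rewrite /heavy -ltNge /contribution big1 // => A _.
rewrite /link; case: ifP => // _; apply/eqP/negPn/negP => /wk[_].
by rewrite subUset sub1set (negbTE xC).
Qed.

(** A heavy element of [I] is selected, hence in [I']; a heavy element outside [I] is outside [I'].
    Both runs branch alike. *)
Lemma scan_replay I I' u s :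
  scan_sel I u s \subset I' -> I' \subset I -> scan I' u s = scan I u s.
Proof.
move=> + sI; elim: s u => [//|x s IH] u; rewrite /scan_sel !scanE.
case: ifP => // hx; last exact: IH.
case: ifP => xI /=.
  by rewrite subUset sub1set => /andP[-> sT]; rewrite /scan_weight /scan_sel /scan_rej IH.
move=> sT; have /negbTE-> : x \notin I' by apply: contraFN xI; apply: (subsetP sI).
by rewrite /scan_weight /scan_sel /scan_rej IH.
Qed.

Hypothesis w0 : weight w.

Lemma link_ge0 u x A : 0 <= link u x A.
Proof. by rewrite /link; case: ifP. Qed.

Lemma link_le u x A : link u x A <= if x \notin A then w (x |: A) else 0.
Proof. by rewrite /link; case: (x \notin A) => //=; case: ifP. Qed.

Lemma add_link_ge u x A : u A <= add_link u x A.
Proof. by rewrite lerDl link_ge0. Qed.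

Lemma scan_weight_ge I u s A : u A <= scan_weight I u s A.
Proof.
elim: s u => [//|x s IH] u; rewrite /scan_weight.
case: (scanP I u x s) => //= *; exact: le_trans (add_link_ge _ _ _) (IH _).
Qed.

Lemma deg_add_link u x B :
  deg (add_link u x) B = deg u B + \sum_(A : {set X} | B \subset A) link u x A.
Proof. by rewrite /deg big_split. Qed.

Lemma unsaturated_le u u' A :
  (forall A, u A <= u' A) -> unsaturated u' A -> unsaturated u A.
Proof.
move=> le_u /forallP us; apply/forallP => B; apply/implyP => sBA.
by have /implyP/(_ sBA) := us B; apply: contra => sat; apply: le_trans sat (ler_deg _ le_u).
Qed.

Lemma contribution_le u u' x :
  (forall A, u A <= u' A) -> contribution u' x <= contribution u x.
Proof.
move=> le_u; apply: ler_sum => A _; rewrite /link.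
case: (x \notin A) => //=; case: ifP => [/(unsaturated_le le_u)-> //|_].
by case: ifP.
Qed.

(** Contributions only decrease as [u] grows, so an element heavy at the end was heavy when it was
    scanned. *)
Lemma heavy_scanned I u s x : x \in s -> heavy (scan_weight I u s) x ->
  x \in scan_sel I u s :|: scan_rej I u s.
Proof.
elim: s u => [//|y s IH] u; rewrite inE.
have [-> _ hy|/= neq_xy xs] := eqVneq x y.
  have hu : heavy u y.
    by apply: le_trans hy (contribution_le _ (scan_weight_ge _ _ _)).
  rewrite /scan_sel /scan_rej; case: (scanP I u y s) => /=; rewrite ?hu //.
  - by rewrite !inE eqxx.
  - by rewrite !inE eqxx orbT.
rewrite /scan_sel /scan_rej /scan_weight.
case: (scanP I u y s) => /= [_ _|_ _|_] /(IH _ xs); rewrite !inE // => /orP[->|->]; rewrite ?orbT //.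
Qed.

(** Each selected element is heavy, so it raises the total derived weight by at least [theta]. *)
Lemma card_scan_sel I u s : 0 <= theta ->
  #|scan_sel I u s|%:R * theta + deg u set0 <= deg (scan_weight I u s) set0.
Proof.
move=> th0; elim: s u => [|x s IH] u.
  by rewrite /scan_sel /scan_weight /= cards0 mul0r add0r.
rewrite /scan_sel /scan_weight; case: (scanP I u x s) => //= hx _.
apply: le_trans (IH _); rewrite deg_add_link.
rewrite [X in _ + (_ + X)](eq_bigl predT) => [|A]; last by rewrite sub0set.
have le_card : #|x |: scan_sel I (add_link u x) s|%:R * theta
    <= (1 + #|scan_sel I (add_link u x) s|%:R) * theta.
  by rewrite ler_wpM2r // nat1r ler_nat cardsU1; case: (x \notin _).
move: hx; rewrite /heavy /contribution; lra.
Qed.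

Lemma deg_link u x B : \sum_(A : {set X} | B \subset A) link u x A <=
  if x \in B then 0 else deg w (x |: B).
Proof.
case: ifP => xB.
  rewrite big1 // => A sBA; rewrite /link.
  by rewrite (subsetP sBA _ xB).
apply: le_trans (ler_sum _ (fun A _ => link_le u x A)) _.
rewrite -big_mkcondr /= (eq_bigl (fun A => (x \notin A) && (x |: B \subset x |: A))); last first.
  move=> A; rewrite andbC; case: (boolP (x \in A)) => //= xA.
  rewrite subUset sub1set setU11 /=; apply/idP/idP => [/subset_trans->//|]; first exact: subsetUr.
  move=> sBA; apply/subsetP => y yB; have := subsetP sBA _ yB.
  by rewrite !inE => /orP[/eqP eq_yx|//]; rewrite -eq_yx yB in xB.
rewrite big_mkcondr /= (reindex_setU1 x (fun A => if x |: B \subset A then w A else 0)).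
rewrite -big_mkcondr /= /deg [leRHS](bigID (fun A => x \in A)) /=.
rewrite (eq_bigl (fun A : {set X} => (x |: B \subset A) && (x \in A))) => [|A]; last exact: andbC.
by rewrite lerDl sumr_ge0.
Qed.

(** Only the last increment can overshoot: before it the degree is below the threshold, it adds at
    most [d], and later links avoid all sets containing [B]. *)
Lemma deg_scan_weight I u s B (d : R) :
    (forall x, x \notin B -> deg w (x |: B) <= d) -> 0 <= d ->
  deg u B <= D #|B| + d -> deg (scan_weight I u s) B <= D #|B| + d.
Proof.
move=> le_d d0; elim: s u => [//|x s IH] u degu; rewrite /scan_weight.
case: (scanP I u x s) => [_ _|_ _|_] /=; apply: IH => //.
rewrite deg_add_link; have [sat|] := boolP (saturated u B).
  rewrite big1 ?addr0 // => A sBA; rewrite /link.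
  case: (x \notin A) => //=; case: ifP => // /forallP/(_ B)/implyP/(_ sBA).
  by rewrite sat.
rewrite /saturated -ltNge => /ltW lt_D; apply: lerD => //.
by apply: le_trans (deg_link _ _ _) _; case: ifP => // /negbT; apply: le_d.
Qed.

Lemma uniform_scan_weight I u s k C :
  uniform w k.+1 C -> uniform u k C -> uniform (scan_weight I u s) k C.
Proof.
move=> wk; elim: s u => [//|x s IH] u uk; rewrite /scan_weight.
case: (scanP I u x s) => [_ _|_ _|_] /=; apply: IH => // A.
have [uA|/uk//] := eqVneq (u A) 0.
rewrite /add_link uA add0r /link; case: ifP => [/andP[xA _]|]; last by rewrite eqxx.
move=> /wk[]; rewrite cardsU1 xA => -[<-]; rewrite subUset => /andP[_ ->] //.
Qed.

Lemma scan_weight_le I u s A : scan_weight I u s A <=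
  u A + \sum_(x <- s | (x \in I) && (x \notin A)) w (x |: A).
Proof.
elim: s u => [|x s IH] u; first by rewrite big_nil addr0.
rewrite /scan_weight big_cons; case: (scanP I u x s) => /= [_ xI|_ xI|_].
- rewrite xI /=; apply: le_trans (IH _) _; rewrite /add_link.
  by have := link_le u x A; case: (x \notin A) => /= le_l; lra.
- by rewrite (negbTE xI); apply: IH.
- by apply: le_trans (IH _) _; case: ifP => // _; have := w0 (x |: A); lra.
Qed.

(** Selected elements lie in [I], so derived weight on a set inside [I] comes from edges inside [I],
    and each edge is used at most once per element. Thus sparseness of [I] is inherited. *)
Lemma mass_scan_weight I k C : uniform w k.+1 C ->
  mass (scan_weight I (fun=> 0) (enum X)) I <= k.+1%:R * mass w I.
Proof.
move=> wk; apply: le_trans (ler_sum _ (fun A _ => scan_weight_le I _ _ A)) _.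
under eq_bigr do rewrite add0r big_enum_cond /=.
rewrite (exchange_big_dep (fun x => x \in I)) /= => [|A x _ /andP[]//].
have E x : x \in I ->
    \sum_(A : {set X} | (A \subset I) && ((x \in I) && (x \notin A))) w (x |: A)
    = \sum_(A : {set X} | (A \subset I) && (x \in A)) w A.
  move=> xI; rewrite (eq_bigl (fun A => (x \notin A) && (x |: A \subset I))); last first.
    by move=> A; rewrite xI subUset sub1set xI /= andbC.
  rewrite big_mkcondr /= (reindex_setU1 x (fun A => if A \subset I then w A else 0)).
  by rewrite -big_mkcondr /=; apply: eq_bigl => A; rewrite andbC.
rewrite (eq_bigr _ E) (exchange_big_dep (fun A => A \subset I)) /= => [|x A _ /andP[]//].
rewrite mulr_sumr; apply: ler_sum => A sAI.
rewrite sumr_const; have [->|/wk[cA _]] := eqVneq (w A) 0; first by rewrite mul0rn mulr0.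
rewrite -[leLHS]mulr_natl ler_wpM2r // ler_nat -cA; apply: subset_leq_card.
by apply/subsetP => x; rewrite unfold_in => /and3P[].
Qed.

(** Being unsaturated passes to subsets, so a surviving edge is counted in the contribution of each
    of its elements; its size k+1 guarantees at least one. *)
Lemma sum_contribution u k C : uniform w k.+1 C ->
  \sum_(A : {set X} | unsaturated u A) w A <= \sum_(x in C) contribution u x.
Proof.
move=> wk.
have le_c x : \sum_(A : {set X} | (x \in A) && unsaturated u A) w A <= contribution u x.
  rewrite big_mkcondr /= -(reindex_setU1 x (fun A => if unsaturated u A then w A else 0)).
  rewrite /contribution big_mkcond; apply: ler_sum => A _; rewrite /link.
  case: (x \notin A) => //=; case: ifP => [us|]; last by case: ifP.
  rewrite ifT //; apply/forallP => B; apply/implyP => sBA.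
  by have /forallP/(_ B)/implyP := us; apply; apply: subset_trans sBA (subsetUr _ _).
apply: le_trans (ler_sum _ (fun x _ => le_c x)).
rewrite (exchange_big_dep (unsaturated u)) /= => [|x A _ /andP[]//].
apply: ler_sum => A us; rewrite sumr_const.
have [->|/wk[cA sAC]] := eqVneq (w A) 0; first by rewrite mul0rn.
rewrite -[leRHS]mulr_natl -[leLHS]mul1r ler_wpM2r // ler1n.
have [x xA|A0] := pickP (mem A).
  by apply/card_gt0P; exists x; rewrite unfold_in /= (subsetP sAC) //=; apply/andP.
by have := cA; rewrite eq_card0.
Qed.

Lemma contribution_le_deg u x : contribution u x <= deg w [set x].
Proof.
rewrite -[[set x]]setU0; have := deg_link u x set0; rewrite inE; apply: le_trans.
by rewrite /contribution; under [leRHS]eq_bigl do rewrite sub0set.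
Qed.

(** Charge an edge to a saturated subset [B]. Saturation turns the bound [L * D #|B|] on its
    [w]-degree into [L * deg u B], and these sum up by [sum_deg]. The degree bound is available
    because the empty set is not saturated. *)
Lemma sum_saturated u (L : R) k C : uniform u k C -> weight u -> 0 <= L ->
    ~~ saturated u set0 ->
    (forall B, B != set0 -> deg w B <= L * D #|B|) ->
  \sum_(A : {set X} | ~~ unsaturated u A) w A <= L * 2 ^+ k * deg u set0.
Proof.
move=> uk u0 L0 nsat0 le_L.
have le1 : \sum_(A : {set X} | ~~ unsaturated u A) w A <=
    \sum_(B : {set X} | saturated u B) deg w B.
  rewrite /deg (exchange_big_dep predT) //= [leLHS]big_mkcond; apply: ler_sum => A _.
  case: ifP => [|_]; last by apply: sumr_ge0.
  rewrite negb_forall => /existsP[B]; rewrite negb_imply negbK => /andP[sBA satB].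
  by rewrite (bigD1 B) ?satB //= lerDl sumr_ge0.
apply: le_trans le1 _; rewrite -mulrA -(sum_deg uk) mulr_sumr big_mkcond.
apply: ler_sum => B _; case: ifP => [satB|_]; last by rewrite mulr_ge0 // deg_ge0.
apply: le_trans (le_L B _) _; first by apply: contraNneq nsat0 => <-.
by rewrite ler_wpM2l.
Qed.

(* If the derived weight stays below D 0 then few edges meet a saturated set,
   so the contributions of the heavy elements carry most of the weight. *)
Lemma scan_dichotomy I k C (a L d1 : R) :
    uniform w k.+1 C -> 0 <= L -> 0 <= d1 -> 0 <= theta ->
    (forall B, B != set0 -> deg w B <= L * D #|B|) ->
    (forall x, deg w [set x] <= d1) ->
    a <= deg w set0 -> L * 2 ^+ k * D 0%N <= a / 2 -> theta * #|C|%:R <= a / 4 ->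
  let u := scan_weight I (fun=> 0) (enum X) in
  let T := scan_sel I (fun=> 0) (enum X) in
  let Z := scan_rej I (fun=> 0) (enum X) in
  D 0%N <= deg u set0 \/ a / 4 <= (#|T| + #|Z|)%:R * d1.
Proof.
move=> wk L0 d10 th0 le_L le_d1 le_a le_a2 le_a4 u T Z.
have [|lt_u] := leP (D 0%N) (deg u set0); first by left.
right; have u0 : weight u by move=> A; apply: scan_weight_ge.
have uk : uniform u k C by apply: uniform_scan_weight => // A; rewrite eqxx.
have nsat0 : ~~ saturated u set0 by rewrite /saturated cards0 -ltNge.
have le1 := sum_saturated uk u0 L0 nsat0 le_L.
have le2 := sum_contribution u wk.
have le3 : L * 2 ^+ k * deg u set0 <= L * 2 ^+ k * D 0%N.
  by apply: ler_wpM2l (ltW lt_u); rewrite mulr_ge0 // exprn_ge0.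
have split_w : deg w set0 = \sum_(A : {set X} | unsaturated u A) w A
     + \sum_(A : {set X} | ~~ unsaturated u A) w A.
  rewrite /deg (eq_bigl predT) => [|A]; last by rewrite sub0set.
  by rewrite (bigID (unsaturated u)).
(* Light elements contribute at most [theta] each; heavy ones were selected or rejected and
   contribute at most [d1] each. *)
have le4 : \sum_(x in C) contribution u x <= (#|T| + #|Z|)%:R * d1 + theta * #|C|%:R.
  rewrite (bigID (heavy u)) /=; apply: lerD; last first.
    apply: (@le_trans _ _ (\sum_(x in C) theta)); last by rewrite sumr_const mulr_natr.
    rewrite big_mkcondr /=; apply: ler_sum => x _.
    by case: ifP => //; rewrite /heavy -ltNge => /ltW.
  apply: (@le_trans _ _ (\sum_(x in T :|: Z) d1)); last first.
    by rewrite sumr_const -[leLHS]mulr_natl ler_wpM2r // ler_nat cardsU leq_subr.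
  rewrite big_mkcond [leRHS]big_mkcond; apply: ler_sum => x _; case: ifP => [/andP[_ hx]|_].
    rewrite ifT; first exact: le_trans (contribution_le_deg _ _) (le_d1 x).
    by apply: heavy_scanned => //; rewrite mem_enum.
  by case: ifP.
lra.
Qed.

End OnePass.

(** * Iterating the scan down to the empty set *)

Section Levels.
Variables (k : nat) (K eps q M N : R).
Hypotheses (K1 : 1 <= K) (eps0 : 0 < eps) (q0 : 0 < q) (M0 : 0 < M) (qN : 1 <= q * N).

Let L : R := K + k%:R.
(* The derived weight at depth d lives on (k - d)-sets and has degrees at most
   (K + d) q^(d + j - 1) M on j-sets. Passing to depth d + 1 either yields total
   weight level_density d.+1 * q^(d + 1) M N or rejects level_rej_const * N
   elements. *)
Definition level_ratio : R := (2 ^+ k.+1 * L)^-1.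
Definition level_density d : R := eps * level_ratio ^+ d.
Definition level_sel_const : R := 4 * (level_ratio + L / level_density k).
Definition level_rej_const : R := level_density k / (8 * L).

(** Index 0 is the weight aimed at for depth d+1. For j > 0 the value has the size of the degree of
    a (j+1)-set at depth d, so that one pass only adds 1 to the degree constant. *)
Definition level_threshold d j : R :=
  if j is 0 then level_density d.+1 * q ^+ d.+1 * (M * N) else q ^+ (d + j) * M.
(** A quarter of the weight expected at depth d, divided by [N]: all light elements together carry
    at most that quarter. *)
Definition level_heavy d : R := level_density d * q ^+ d * M / 4.

Fixpoint levels I n d w : ({set X} -> R) * {set X} * {set X} :=
  if n is n'.+1 then
    let: (u, T, Z) := scan w (level_threshold d) (level_heavy d) I (fun=> 0) (enum X) in
    let: (u', T', Z') := levels I n' d.+1 u in (u', T :|: T', Z :|: Z')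
  else (w, set0, set0).

Definition level_weight I d w :=
  scan_weight w (level_threshold d) (level_heavy d) I (fun=> 0) (enum X).
Definition level_sel I d w :=
  scan_sel w (level_threshold d) (level_heavy d) I (fun=> 0) (enum X).
Definition level_rej I d w :=
  scan_rej w (level_threshold d) (level_heavy d) I (fun=> 0) (enum X).

Lemma levelsS I n d w : levels I n.+1 d w =
  ((levels I n d.+1 (level_weight I d w)).1.1,
   level_sel I d w :|: (levels I n d.+1 (level_weight I d w)).1.2,
   level_rej I d w :|: (levels I n d.+1 (level_weight I d w)).2).
Proof.
rewrite /= /level_weight /level_sel /level_rej /scan_weight /scan_sel /scan_rej.
by case: (scan _ _ _ _ _ _) => [[u T] Z] /=; case: (levels _ _ _ _) => [[]].
Qed.

Lemma levels_sel_sub I n d w : (levels I n d w).1.2 \subset I.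
Proof.
elim: n d w => [|n IH] d w; first by rewrite sub0set.
by rewrite levelsS /= subUset scan_sel_sub IH.
Qed.

Lemma levels_rej_sub I n d w : (levels I n d w).2 \subset ~: I.
Proof.
elim: n d w => [|n IH] d w; first by rewrite sub0set.
by rewrite levelsS /= subUset scan_rej_sub IH.
Qed.

Lemma levels_replay I I' n d w :
  (levels I n d w).1.2 \subset I' -> I' \subset I -> levels I' n d w = levels I n d w.
Proof.
move=> + sI; elim: n d w => [//|n IH] d w; rewrite !levelsS [X in X \subset _]/= subUset => /andP[sT sT'].
have E := scan_replay sT sI.
have -> : level_weight I' d w = level_weight I d w by rewrite /level_weight /scan_weight E.
have -> : level_sel I' d w = level_sel I d w by rewrite /level_sel /scan_sel E.
have -> : level_rej I' d w = level_rej I d w by rewrite /level_rej /scan_rej E.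
by rewrite (IH _ _ sT').
Qed.

Let L1 : 1 <= L. Proof. by rewrite (le_trans K1) // lerDl. Qed.
Let L0 : 0 < L. Proof. exact: lt_le_trans L1. Qed.
Let ratio0 : 0 < level_ratio.
Proof. by rewrite invr_gt0 mulr_gt0 // exprn_gt0. Qed.
Let ratio1 : level_ratio <= 1.
Proof.
rewrite invf_le1 ?mulr_gt0 ?exprn_gt0 //.
have : 1 <= 2 ^+ k.+1 :> R by apply: exprn_ege1; rewrite ler1n.
by move=> H; apply: mulr_ege1.
Qed.
Let density0 d : 0 < level_density d.
Proof. by rewrite mulr_gt0 // exprn_gt0. Qed.
Let densityS d : level_density d.+1 = level_density d * level_ratio.
Proof. by rewrite /level_density exprSr mulrA. Qed.
Let density_le d : (d <= k)%N -> level_density k <= level_density d.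
Proof.
move=> le_dk; rewrite ler_pM2l //; apply: ler_wiXn2l => //; exact: ltW.
Qed.
Let N0 : 0 < N.
Proof. by rewrite -(pmulr_rgt0 _ q0); apply: lt_le_trans qN. Qed.
Let heavy0 d : 0 < level_heavy d.
Proof. by rewrite divr_gt0 // !mulr_gt0 ?exprn_gt0. Qed.

Definition level_invariant d w C :=
  [/\ weight w, uniform w (k - d) C &
      forall B, B != set0 -> deg w B <= (K + d%:R) * (q ^+ (d + #|B|).-1 * M)].

Lemma level_weight_invariant I d w C : (d < k)%N ->
  level_invariant d w C -> level_invariant d.+1 (level_weight I d w) C.
Proof.
move=> lt_dk [w0 wk le_deg]; split.
- by move=> A; apply: scan_weight_ge.
- by apply: uniform_scan_weight; rewrite ?subnSK // => A; rewrite eqxx.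
move=> B nB; have [j cB] : exists j, #|B| = j.+1.
  by exists #|B|.-1; rewrite prednK // card_gt0.
have -> : (K + d.+1%:R) * (q ^+ (d.+1 + #|B|).-1 * M)
    = level_threshold d #|B| + (K + d%:R) * (q ^+ (d + #|B|) * M).
  by rewrite cB addSn /= -natr1; ring.
have Kd : 0 <= K + d%:R by rewrite addr_ge0 // (le_trans _ K1).
have qM j' : 0 <= q ^+ j' * M by rewrite ltW // mulr_gt0 // exprn_gt0.
apply: deg_scan_weight => //.
- move=> x xB; apply: le_trans (le_deg _ _) _; first by apply/set0Pn; exists x; rewrite setU11.
  by rewrite cardsU1 xB /= add1n addnS.
- by rewrite mulr_ge0.
by rewrite /deg big1 // cB; apply: addr_ge0; [apply: qM | apply: mulr_ge0].
Qed.

Lemma level_deg1 d w C x : (d <= k)%N -> level_invariant d w C ->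
  deg w [set x] <= L * (q ^+ d * M).
Proof.
move=> le_dk [_ _ le_deg]; apply: le_trans (le_deg _ _) _.
  by apply/set0Pn; exists x; rewrite set11.
rewrite cards1 addn1 /= ler_wpM2r //; first by rewrite ltW // mulr_gt0 // exprn_gt0.
by rewrite lerD2l ler_nat.
Qed.

(** The derived weight is at most its target plus one increment, and each selected element accounts
    for [level_heavy d] of it. The increment yields a term without the factor [q * N], absorbed by
    [1 <= q * N]. *)
Lemma card_level_sel I d w C : (d <= k)%N -> level_invariant d w C ->
  #|level_sel I d w|%:R <= level_sel_const * (q * N).
Proof.
move=> le_dk inv; have [w0 wk _] := inv.
have y0 : 0 < q ^+ d * M by rewrite mulr_gt0 // exprn_gt0.
have := @card_scan_sel w (level_threshold d) (level_heavy d) I (fun=> 0) (enum X)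
          (ltW (heavy0 d)).
have := @deg_scan_weight w (level_threshold d) (level_heavy d) w0 I (fun=> 0) (enum X) set0
          (L * (q ^+ d * M)).
rewrite -/(level_weight I d w) -/(level_sel I d w) cards0 /deg big1 //.
move=> H1 H2.
have {H1} H1 : deg (level_weight I d w) set0 <= level_threshold d 0 + L * (q ^+ d * M).
  apply: H1; last 2 first.
  - by rewrite mulr_ge0 // ltW.
  - by rewrite addr_ge0 ?mulr_ge0 // ?ltW // ?mulr_gt0 ?exprn_gt0.
  by move=> x _; rewrite setU0; apply: level_deg1 inv.
have := le_trans H2 H1; rewrite addr0 {H1 H2} /level_heavy /level_threshold densityS.
have -> : level_density d * q ^+ d * M / 4 = level_density d / 4 * (q ^+ d * M) by ring.
have -> : level_density d * level_ratio * q ^+ d.+1 * (M * N) + L * (q ^+ d * M)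
  = (level_density d * level_ratio * (q * N) + L) * (q ^+ d * M) by rewrite exprS; ring.
rewrite mulrA ler_pM2r // => H.
have HL : L <= level_density d * (L / level_density k * (q * N)).
  have -> : level_density d * (L / level_density k * (q * N))
     = level_density d / level_density k * (q * N) * L by ring.
  apply: ler_peMl; first exact: ltW.
  apply: mulr_ege1 => //.
  by rewrite ler_pdivlMr // mul1r density_le.
have dd := density0 d.
rewrite -(ler_pM2l dd); move: HL H; rewrite /level_sel_const.
set c := level_density d; set a := L / level_density k; set T := #|_|%:R.
move=> HL H; have -> : c * (4 * (level_ratio + a) * (q * N)) =
  4 * (c * level_ratio * (q * N) + c * (a * (q * N))) by ring.
lra.
Qed.

Lemma card_levels_sel I n d w C : (d + n = k)%N -> level_invariant d w C ->
  #|(levels I n d w).1.2|%:R <= n%:R * (level_sel_const * (q * N)).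
Proof.
elim: n d w => [|n IH] d w dn inv; first by rewrite cards0 mul0r.
rewrite levelsS /=; have lt_dk : (d < k)%N by rewrite -dn addnS ltnS leq_addr.
apply: (@le_trans _ _ (#|level_sel I d w| + #|(levels I n d.+1 (level_weight I d w)).1.2|)%:R).
  by rewrite ler_nat cardsU leq_subr.
rewrite natrD -nat1r mulrDl mul1r; apply: lerD; first exact: card_level_sel (ltnW lt_dk) inv.
by apply: IH; [rewrite addSnnS | apply: level_weight_invariant].
Qed.

Lemma levels_rej_support I n d w C : (d + n = k)%N -> level_invariant d w C ->
  (levels I n d w).2 \subset C.
Proof.
elim: n d w => [|n IH] d w dn inv; first by rewrite sub0set.
rewrite levelsS /= subUset; have lt_dk : (d < k)%N by rewrite -dn addnS ltnS leq_addr.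
have [_ wk _] := inv; rewrite (scan_rej_support _ _ _ _ _ wk) ?heavy0 //=.
by apply: IH; [rewrite addSnnS | apply: level_weight_invariant].
Qed.

(** Induction over the remaining depths. At depth k the weight sits on the empty set, hence inside
    [I], where the density bound contradicts sparseness; so some earlier depth must fall on the
    rejecting side of the dichotomy. The power of k pays for the remaining passes. *)
Lemma card_levels_rej I n d w C : (d + n = k)%N -> level_invariant d w C ->
    #|C|%:R <= N -> level_sel_const * q <= level_rej_const ->
    level_density d * q ^+ d * (M * N) <= deg w set0 ->
    k%:R ^+ n * mass w I < level_density k * q ^+ k * (M * N) ->
  level_rej_const * N <= #|(levels I n d w).2|%:R.
Proof.
move=> + + CN qsmall; elim: n d w => [|n IH] d w dn inv le_w lt_I.
  have [_ wk _] := inv; move: (dn) lt_I le_w; rewrite addn0 => ->.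
  rewrite mul1r => lt_I /(lt_le_trans lt_I); rewrite -(@mass_uniform w 0 I) ?ltxx //.
  move=> A /wk[/eqP]; rewrite -dn addn0 subnn cards_eq0 => /eqP-> _.
  by rewrite cards0 sub0set.
rewrite levelsS /=; have lt_dk : (d < k)%N by rewrite -dn addnS ltnS leq_addr.
have inv' := level_weight_invariant I lt_dk inv; have [w0 wk le_deg] := inv.
have y0 : 0 < q ^+ d * M by rewrite mulr_gt0 // exprn_gt0.
have wk' : uniform w (k - d.+1).+1 C by rewrite subnSK.
(* The constant is [L / q] because the thresholds carry one more power of [q] than the degrees of
   [w]. *)
have [] := @scan_dichotomy w (level_threshold d) (level_heavy d) w0 I _ C
  (level_density d * q ^+ d * (M * N)) (L / q) (L * (q ^+ d * M)) wk'.
- by rewrite ltW // divr_gt0.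
- by rewrite ltW // mulr_gt0.
- exact: ltW.
- move=> B nB; apply: le_trans (le_deg B nB) _.
  have [j ->] : exists j, #|B| = j.+1 by exists #|B|.-1; rewrite prednK // card_gt0.
  have -> : L / q * level_threshold d j.+1 = L * (q ^+ (d + j) * M).
    by rewrite /level_threshold addnS exprS; field; rewrite gt_eqF.
  rewrite addnS /=.
  apply: ler_wpM2r; first by rewrite mulr_ge0 ?exprn_ge0 ?ltW.
  by rewrite /L lerD2l ler_nat ltnW.
- by move=> x; apply: level_deg1 inv; apply: ltnW.
- exact: le_w.
- rewrite /level_threshold densityS exprS.
  have -> : L / q * 2 ^+ (k - d.+1) *
      (level_density d * level_ratio * (q * q ^+ d) * (M * N)) =
      (L * 2 ^+ (k - d.+1) * level_ratio) * (level_density d * q ^+ d * (M * N)).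
    by field; rewrite gt_eqF.
  rewrite [leRHS]mulrC; apply: ler_wpM2r; first by rewrite !mulr_ge0 ?exprn_ge0 ?ltW.
  rewrite /level_ratio ler_pdivrMr ?mulr_gt0 ?exprn_gt0 // mulrA exprS.
  rewrite [2^-1 * _]mulrA mulVf ?pnatr_eq0 // mul1r mulrC; apply: ler_wpM2r; first exact: ltW.
  by apply: ler_weXn2l; rewrite ?ler1n // leq_subr.
- have c0 : 0 <= level_density d * q ^+ d * M by rewrite !mulr_ge0 ?exprn_ge0 ?ltW.
  by have := ler_wpM2l c0 CN; rewrite /level_heavy; lra.
- rewrite -/(level_weight I d w) => le_u.
  apply: le_trans (IH _ _ _ inv' le_u _) _; first by rewrite addSnnS.
    apply: le_lt_trans lt_I; rewrite exprSr -mulrA ler_wpM2l ?exprn_ge0 //.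
    apply: le_trans (mass_scan_weight _ _ w0 I wk') _.
    apply: ler_wpM2r; first exact: sumr_ge0.
    by rewrite ler_nat subnSK // leq_subr.
  by rewrite ler_nat subset_leq_card // subsetUr.
rewrite -/(level_sel I d w) -/(level_rej I d w) => H.
apply: (@le_trans _ _ #|level_rej I d w|%:R); last by rewrite ler_nat subset_leq_card // subsetUl.
have Hs := card_level_sel I (ltnW lt_dk) inv.
have : level_density d / 4 * N <= (#|level_sel I d w| + #|level_rej I d w|)%:R * L.
  rewrite -(ler_pM2r y0) -[leRHS]mulrA; apply: le_trans H.
  by rewrite le_eqVlt; apply/orP; left; apply/eqP; ring.
rewrite -ler_pdivrMr // natrD => {}H.
(* At least [2 * level_rej_const * N] elements are selected or rejected; as [q] is small, the
   selected ones make up at most half of this. *)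
have : 2 * level_rej_const * N <= level_density d / 4 * N / L.
  have -> : 2 * level_rej_const * N = level_density k * (N / 4 / L).
    by rewrite /level_rej_const; field; rewrite gt_eqF.
  have -> : level_density d / 4 * N / L = level_density d * (N / 4 / L) by ring.
  by apply: ler_wpM2r; [rewrite !divr_ge0 ?ltW | rewrite density_le // ltnW].
have : level_sel_const * (q * N) <= level_rej_const * N by rewrite mulrA ler_wpM2r // ltW.
lra.
Qed.

End Levels.

(** * Repeated shrinking of the ground set and the container theorem *)

Definition restrict w C A : R := if A \subset C then w A else 0.

Lemma deg_restrict w C : deg (restrict w C) set0 = mass w C.
Proof.
rewrite /deg /mass [RHS]big_mkcond; apply: eq_bigl => A; exact: sub0set.
Qed.

Section Shrink.
Variables (k : nat) (K eps q M N : R) (w : {set X} -> R).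

Definition shrink I C :=
  let r := levels k K eps q M N I k 0 (restrict w C) in (r.1.2, C :\: r.2).

Fixpoint shrink_iter I m C : {set X} * {set X} :=
  if m is m'.+1 then
    let r := shrink I C in let r' := shrink_iter I m' r.2 in (r.1 :|: r'.1, r'.2)
  else (set0, C).

Lemma shrink_iterS I m C : shrink_iter I m.+1 C =
  ((shrink I C).1 :|: (shrink_iter I m (shrink I C).2).1,
   (shrink_iter I m (shrink I C).2).2).
Proof. by []. Qed.

Lemma shrink_iter_sub I m C : I \subset C ->
  (shrink_iter I m C).1 \subset I /\ I \subset (shrink_iter I m C).2.
Proof.
elim: m C => [|m IH] C sIC /=; first by rewrite sub0set.
set r := levels _ _ _ _ _ _ _ _ _ _.
have [|sT sI] := IH (C :\: r.2).
  by rewrite subsetD sIC disjoint_sym disjoints_subset levels_rej_sub.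
by rewrite subUset levels_sel_sub sT.
Qed.

Lemma shrink_iter_replay I I' m C : (shrink_iter I m C).1 \subset I' -> I' \subset I ->
  shrink_iter I' m C = shrink_iter I m C.
Proof.
move=> + sI; elim: m C => [//|m IH] C; rewrite !shrink_iterS [X in X \subset _]/= subUset => /andP[sT sT'].
have E : shrink I' C = shrink I C by rewrite /shrink (levels_replay sT sI).
by rewrite E IH.
Qed.

Hypotheses (K1 : 1 <= K) (eps0 : 0 < eps) (q0 : 0 < q) (M0 : 0 < M) (qN : 1 <= q * N).
Hypothesis qsmall : level_sel_const k K eps * q <= level_rej_const k K eps.
Hypothesis w0 : weight w.
Variable S : {set X}.
Hypotheses (wk : uniform w k S) (SN : #|S|%:R <= N).
Hypothesis w_deg : forall B, B != set0 -> deg w B <= K * (q ^+ #|B|.-1 * M).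

Lemma restrict_invariant C : level_invariant k K q M 0 (restrict w C) C.
Proof.
split.
- by move=> A; rewrite /restrict; case: ifP.
- by move=> A; rewrite /restrict subn0; case: ifP => [sAC /wk[]|]; rewrite ?eqxx.
move=> B nB; rewrite addr0; apply: le_trans (w_deg nB); apply: ler_deg => A.
by rewrite /restrict; case: ifP.
Qed.

Lemma card_shrink_iter I m C :
  #|(shrink_iter I m C).1|%:R <= m%:R * (k%:R * (level_sel_const k K eps * (q * N))).
Proof.
elim: m C => [|m IH] C /=; first by rewrite cards0 mul0r.
rewrite -nat1r mulrDl mul1r; set T := (levels _ _ _ _ _ _ _ _ _ _).1.2.
apply: (@le_trans _ _ (#|T|%:R + #|(shrink_iter I m (shrink I C).2).1|%:R)).
  by rewrite -natrD ler_nat cardsU leq_subr.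
apply: lerD; last exact: IH.
exact: (card_levels_sel K1 eps0 q0 M0 qN I (add0n k) (restrict_invariant C)).
Qed.

(** A round that starts from mass at least [eps * (M * N)] removes [level_rej_const * N] elements,
    and [C] is too small for [m] such rounds. Once the mass is below the target it stays there,
    since the set only shrinks. *)
Lemma mass_shrink_iter I m C : C \subset S -> I \subset C ->
    k%:R ^+ k * mass w I < level_density k K eps k * q ^+ k * (M * N) ->
    #|C|%:R < m%:R * (level_rej_const k K eps * N) ->
  mass w (shrink_iter I m C).2 < eps * (M * N).
Proof.
move=> + + ltI; elim: m C => [|m IH] C sCS sIC; first by rewrite mul0r ltNge ler0n.
rewrite /= => ltC; set Z := (levels _ _ _ _ _ _ _ _ _ _).2.
have sID : I \subset C :\: Z.
  by rewrite subsetD sIC disjoint_sym disjoints_subset levels_rej_sub.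
have [ltm|lem] := ltP (mass w C) (eps * (M * N)).
  apply: le_lt_trans ltm; apply: massS => //.
  have : (shrink_iter I m (C :\: Z)).2 \subset C :\: Z.
    elim: m {IH ltC sCS sIC sID} (C :\: Z) => [//|m IHm] C' /=.
    exact: subset_trans (IHm _) (subsetDl _ _).
  by move/subset_trans; apply; apply: subsetDl.
apply: IH => //; first exact: subset_trans (subsetDl _ _) sCS.
have CN : #|C|%:R <= N by apply: le_trans SN; rewrite ler_nat subset_leq_card.
have Zbig : level_rej_const k K eps * N <= #|Z|%:R.
  apply: (card_levels_rej K1 eps0 q0 M0 qN (add0n k) (restrict_invariant C)) => //.
    by rewrite deg_restrict /level_density !expr0 !mulr1.
  apply: le_lt_trans ltI; rewrite ler_wpM2l ?exprn_ge0 //.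
  by apply: ler_sum => A _; rewrite /restrict; case: ifP.
have sZC : Z \subset C.
  by apply: levels_rej_support (restrict_invariant C).
move: ltC; rewrite -nat1r mulrDl mul1r -(cardsID Z C) (setIidPr sZC) natrD.
lra.
Qed.

End Shrink.
End WeightedHypergraphs.

(** Sparseness of [I] is measured against q^k M N, the natural scale for a set of density q, and
    enters the mass bound only; the inclusions and the size of the fingerprint hold for every
    [I]. *)
Theorem sparse_containers (R : archiRealFieldType) (k : nat) (K eps : R) :
    1 <= K -> 0 < eps ->
  exists alpha c q1 : R, [/\ 0 < alpha, 0 < c, 0 < q1 &
    forall (X : finType) (S : {set X}) (w : {set X} -> R) (q M N : R),
    0 < q -> q <= q1 -> 0 < M -> 1 <= q * N -> #|S|%:R <= N ->
    weight w -> uniform w k S ->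
    (forall B, B != set0 -> deg w B <= K * (q ^+ #|B|.-1 * M)) ->
    exists F C : {set X} -> {set X}, forall I : {set X}, I \subset S ->
    [/\ F I \subset I, I \subset C (F I), #|F I|%:R <= c * (q * N) &
        mass w I < alpha * (q ^+ k * (M * N)) -> mass w (C (F I)) < eps * (M * N)]].
Proof.
move=> K1 eps0.
have L0 : 0 < K + k%:R by rewrite (lt_le_trans (lt_le_trans ltr01 K1)) // lerDl.
have b0 : 0 < level_ratio k K by rewrite invr_gt0 mulr_gt0 // exprn_gt0.
have d0 d : 0 < level_density k K eps d by rewrite mulr_gt0 // exprn_gt0.
set s := level_sel_const k K eps; set t := level_rej_const k K eps.
have s0 : 0 < s by rewrite mulr_gt0 // addr_gt0 // divr_gt0.
have t0 : 0 < t by rewrite divr_gt0 // mulr_gt0.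
(* More rounds than 1/t, since each one removes at least t N of at most N elements. *)
pose m := (Num.bound (t^-1)).+1.
have k0 : 0 < k%:R ^+ k :> R.
  by case: (k) => [|k']; rewrite ?expr0 // exprn_gt0.
(* The factor k^k pays for k passes, the summand 1 keeps the second constant positive when k = 0,
   and q <= t / s is the smallness needed to separate selected from rejected elements. *)
exists (level_density k K eps k / k%:R ^+ k), (m%:R * (k%:R * s) + 1), (t / s).
split; [exact: divr_gt0 | | exact: divr_gt0 | ].
  by apply: ltr_wpDl; rewrite ?ltr01 // mulr_ge0 ?ler0n // mulr_ge0 ?ler0n // ltW.
move=> X S w q M N q0; rewrite ler_pdivlMr // mulrC => qs M0 qN SN w0 wk w_deg.
have N0 : 0 < N by rewrite -(pmulr_rgt0 _ q0); apply: lt_le_trans qN.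
(* The container of a fingerprint is obtained by running the algorithm on the fingerprint itself; by
   replay the outcome is that of [I]. *)
exists (fun I => (shrink_iter k K eps q M N w I m S).1),
       (fun T => (shrink_iter k K eps q M N w T m S).2) => I sIS.
have [sT sI] := shrink_iter_sub k K eps q M N w m sIS.
rewrite (shrink_iter_replay (subxx _) sT); split => //.
  apply: le_trans (card_shrink_iter K1 eps0 q0 M0 qN w0 wk w_deg I m S) _.
  rewrite -/s; have -> : (m%:R * (k%:R * s) + 1) * (q * N) =
    m%:R * (k%:R * (s * (q * N))) + q * N by ring.
  by rewrite lerDl; apply: le_trans qN.
move=> ltI; apply: (mass_shrink_iter K1 eps0 q0 M0 qN qs w0 wk SN w_deg) => //.
  rewrite mulrC -ltr_pdivlMr //; apply: lt_le_trans ltI _.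
  by rewrite le_eqVlt; apply/orP; left; apply/eqP; ring.
apply: (le_lt_trans SN); rewrite mulrA ltr_pMl // -ltr_pdivrMr // div1r.
apply: lt_trans (archi_boundP _) _; first by rewrite invr_ge0 ltW.
by rewrite ltr_nat.
Qed.

(** * Ramsey supersaturation *)

Section Ramsey.
Local Open Scope nat_scope.

Definition monochromatic (r : nat) (T : finType) (c : T -> T -> 'I_r) (i : 'I_r)
    (B : {set T}) := {in B &, forall x y, x != y -> c x y = i}.

(** Induction on the sum of the targets: fix a vertex, find a large neighbourhood in one colour, and
    lower the target of that colour by one. An element of [A] also provides a colour, as [r] could
    be 0. *)
Lemma ramsey_off_diagonal (r s : nat) (k : 'I_r -> nat) : \sum_i k i <= s ->
  exists N, forall (T : finType) (c : T -> T -> 'I_r) (A : {set T}),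
    (forall x y, c x y = c y x) -> N <= #|A| -> 0 < #|A| ->
    exists (i : 'I_r) (B : {set T}), [/\ B \subset A, k i <= #|B| & monochromatic c i B].
Proof.
elim: s k => [|s IH] k ks.
  exists 0 => T c A _ _ /card_gt0P[a _]; exists (c a a), set0; split.
  - exact: sub0set.
  - move: ks; rewrite leqn0 sum_nat_eq0 => /forallP/(_ (c a a)).
    by rewrite implyTb => /eqP->.
  - by move=> x y; rewrite inE.
have [/existsP[i /eqP ki]|] := boolP [exists i, k i == 0].
  exists 0 => T c A _ _ _; exists i, set0; split; rewrite ?sub0set ?ki //.
  by move=> x y; rewrite inE.
rewrite negb_exists => /forallP k0.
pose k' i j := if j == i then (k j).-1 else k j.
have k's i : \sum_j k' i j <= s.
  move: ks; rewrite (bigD1 i) //= [X in _ -> X <= _](bigD1 i) //= {1}/k' eqxx.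
  have -> : \sum_(j | j != i) k' i j = \sum_(j | j != i) k j.
    by apply: eq_bigr => j /negbTE; rewrite /k' => ->.
  by have := k0 i; case: (k i).
have [N PN] := fin_all_exists (fun i => IH _ (k's i)).
exists (\sum_i (N i).+1).+2 => T c A csym leN /card_gt0P[a aA].
pose nb i := [set x in A :\ a | c a x == i].
have sum_nb : \sum_i #|nb i| = #|A|.-1.
  rewrite (cardsD1 a A) aA /=.
  rewrite -sum1_card (partition_big (c a) predT) //=; apply: eq_bigr => i _.
  by rewrite -sum1_card; apply: eq_bigl => x; rewrite inE.
have [i lti] : exists i, (N i).+1 <= #|nb i|.
  apply/existsP; apply: contraLR leN; rewrite negb_exists => /forallP lt_nb.
  have A0 : 0 < #|A| by apply/card_gt0P; exists a.
  rewrite -ltnNge ltnS -(prednK A0) ltnS -sum_nb; apply: leq_sum => i _.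
  by have := lt_nb i; rewrite -ltnNge ltnS => /leqW.
have [j [B [sB lekB mB]]] := PN i T c (nb i) csym (ltnW lti) (leq_trans (ltn0Sn _) lti).
have sBA : B \subset A.
  by apply/subsetP => x /(subsetP sB); rewrite !inE => /andP[/andP[]].
move: lekB; rewrite /k'; case: eqP => [eq_ji|_] lekB; last by exists j, B.
subst j; exists i, (a |: B); split.
- by rewrite subUset sub1set aA.
- have -> : #|a |: B| = #|B|.+1.
    rewrite cardsU1; case: (boolP (a \in B)) => // /(subsetP sB).
    by rewrite !inE eqxx.
  by rewrite -ltnS prednK ?lt0n in lekB.
have ca x : x \in B -> c a x = i by move/(subsetP sB); rewrite !inE => /andP[_ /eqP].
move=> x y; rewrite !inE => /orP[/eqP->|xB] /orP[/eqP->|yB].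
- by rewrite eqxx.
- by move=> _; apply: ca.
- by move=> _; rewrite csym; apply: ca.
- exact: mB.
Qed.

(** The size is written [m.+2] so that the ground set is nonempty and exactly [m] coordinates stay
    free when two are prescribed. *)
Lemma ramsey_embedding (r : nat) (V : finType) : 0 < r ->
  exists m, forall c : 'I_m.+2 -> 'I_m.+2 -> 'I_r, (forall x y, c x y = c y x) ->
    exists (i : 'I_r) (h : {ffun V -> 'I_m.+2}), injective h /\
      forall x y, x != y -> c (h x) (h y) = i.
Proof.
move=> r0; have [m Pm] := ramsey_off_diagonal (leqnn (\sum_(i < r) #|V|)).
exists m => c csym; have [||i [B [_ leB mB]]] := Pm _ c setT csym; rewrite ?cardsT ?card_ord //.
  exact: leqW.
have h_inj : injective (fun x : V => enum_val (widen_ord leB (enum_rank x))).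
  by move=> x y /enum_val_inj/(congr1 val)/= /val_inj/enum_rank_inj.
exists i, [ffun x => enum_val (widen_ord leB (enum_rank x))]; split.
  by move=> x y; rewrite !ffunE => /h_inj.
move=> x y neq; rewrite !ffunE; apply: mB; try exact: enum_valP.
by apply: contra neq => /eqP/h_inj->.
Qed.

End Ramsey.

(** * Counting maps; the weighted hypergraph of embeddings *)

Lemma leq_card_family_cover (T I : finType) (A : {set T}) (P : pred I) (F : I -> {set T}) :
    (forall x, x \in A -> exists2 i, P i & x \in F i) ->
  (#|A| <= \sum_(i | P i) #|F i|)%N.
Proof.
move=> cov; under eq_bigr do rewrite -sum1_card.
rewrite (exchange_big_dep predT) //= -sum1_card big_mkcond; apply: leq_sum => x _.
case: ifP => // /cov[i Pi xF]; rewrite sum1_card; apply/card_gt0P; exists i.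
by rewrite unfold_in Pi.
Qed.

Lemma card_ffun_constrained (I J : finType) (A : {set I}) (P : I -> {set J}) (b : nat) :
    (forall x, x \in A -> #|P x| <= b)%N ->
  (#|[set g : {ffun I -> J} | [forall x in A, g x \in P x]]| <= b ^ #|A| * #|J| ^ (#|I| - #|A|))%N.
Proof.
move=> leP; pose F x := if x \in A then P x else setT.
apply: (@leq_trans #|family (fun x => mem (F x))|).
  apply: subset_leq_card; apply/subsetP => g; rewrite inE => /forall_inP gP.
  by apply/familyP => x; rewrite /F; case: ifP => [/gP|_]; rewrite ?in_setT.
rewrite card_family foldrE big_map big_enum /= (bigID (mem A)) /=.
apply: leq_mul.
  rewrite -prod_nat_const; apply: leq_prod => x xA; apply: leq_trans (leP x xA).
  by rewrite /F xA; apply: eq_leq; apply: eq_card.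
have -> : (#|I| - #|A| = #|~: A|)%N by rewrite -(cardsC A) addKn.
rewrite (eq_bigl (mem (~: A))) => [|x]; last by rewrite /= inE.
rewrite -prod_nat_const; apply: leq_prod => x /=; rewrite in_setC => /negbTE xA.
by rewrite /F xA max_card.
Qed.

Section Embeddings.
Variables (V : finType) (H : sgraph V) (n : nat).
Implicit Types (f : {ffun V -> 'I_n}) (A B C : {set {set 'I_n}}).

Definition edge_image f : {set {set 'I_n}} := [set f @: (e : {set V}) | e in edges H].
Definition embeddings C := [set f : {ffun V -> 'I_n} | injectiveb f && (edge_image f \subset C)].
Definition pairs : {set {set 'I_n}} := [set e : {set 'I_n} | #|e| == 2%N].
(** Labelled embeddings are weighed because maps are easy to count; there are at least as many of
    them as copies, and at most #|V|^#|V| times as many. *)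
Definition emb_weight (R : realFieldType) A : R :=
  #|[set f : {ffun V -> 'I_n} | injectiveb f && (edge_image f == A)]|%:R.

Variable R : realFieldType.

Lemma sum_emb_weight (P : pred {set {set 'I_n}}) :
  \sum_(A | P A) emb_weight R A
  = #|[set f : {ffun V -> 'I_n} | injectiveb f && P (edge_image f)]|%:R.
Proof.
rewrite -natr_sum; congr _%:R; rewrite -[RHS]sum1_card.
rewrite [RHS](partition_big edge_image P) /= => [|f]; last by rewrite inE => /andP[].
apply: eq_bigr => A PA; rewrite -sum1_card; apply: eq_bigl => f; rewrite !inE.
by case: eqP => [->|]; rewrite ?andbF ?PA ?andbT.
Qed.

Lemma mass_emb_weight C : mass (emb_weight R) C = #|embeddings C|%:R.
Proof. exact: sum_emb_weight (fun A => A \subset C). Qed.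

Lemma deg_emb_weight B : deg (emb_weight R) B
  = #|[set f : {ffun V -> 'I_n} | injectiveb f && (B \subset edge_image f)]|%:R.
Proof. exact: sum_emb_weight (fun A => B \subset A). Qed.

Lemma emb_weight_ge0 : weight (emb_weight R).
Proof. by move=> A; apply: ler0n. Qed.

Lemma card_edge (e : {set V}) : e \in edges H -> #|e| = 2%N.
Proof. by move=> eH; apply/eqP; have /forall_inP := edgesP H; apply. Qed.

Lemma edge_imageP f : injective f ->
  #|edge_image f| = #|edges H| /\ edge_image f \subset pairs.
Proof.
move=> f_inj; split; first by rewrite card_imset //; apply: imset_inj.
apply/subsetP => _ /imsetP[e eH ->]; rewrite inE card_imset //.
by rewrite card_edge.
Qed.

Lemma uniform_emb_weight : uniform (emb_weight R) #|edges H| pairs.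
Proof.
move=> A; rewrite pnatr_eq0 -lt0n => /card_gt0P[f].
by rewrite inE => /andP[/injectiveP/edge_imageP[cf sf] /eqP <-].
Qed.

End Embeddings.

Lemma card_pair_fibre (T : finType) (D : {set {set T}}) :
  (#|[set z : T * T | [set z.1; z.2] \in D & z.1 != z.2]| <= 2 * #|D|)%N.
Proof.
rewrite -sum1_card (partition_big (fun z => [set z.1; z.2]) (mem D)) /=; last first.
  by move=> z; rewrite inE => /andP[].
rewrite mulnC -sum_nat_const; apply: leq_sum => e eD; rewrite sum1dep_card.
set S := [set x in _ | _]; have [->|[[a b]]] := set_0Vmem S; first by rewrite cards0.
rewrite !inE /= => /andP[/andP[_ ab] /eqP eE].
apply: (@leq_trans #|[set (a, b); (b, a)]|); last by rewrite cards2; case: eqP.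
apply: subset_leq_card; apply/subsetP => -[x y].
rewrite !inE /= => /andP[/andP[_ neq_xy] /eqP].
rewrite -eE => exy; have: x \in [set a; b] by rewrite -exy !inE eqxx.
have: y \in [set a; b] by rewrite -exy !inE eqxx orbT.
rewrite !inE !xpair_eqE => /orP[]/eqP yE /orP[]/eqP xE; move: neq_xy;
  by rewrite xE yE !eqxx ?orbT.
Qed.

Section Supersaturation.
Variables (R : realFieldType) (r : nat) (V : finType) (H : sgraph V).

Definition uncovered n (C : 'I_r -> {set {set 'I_n}}) := pairs n :\: \bigcup_i C i.

(** Averaging over all maps [g] from the Ramsey ground set to the vertices, not only injective ones,
    so that counts are powers of n. A map that neither identifies two points nor hits an uncovered
    pair contains an embedding of [H] into some [C i]. *)
Lemma supersaturation : (0 < r)%N ->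
  exists (eps delta : R) (n0 : nat), [/\ 0 < eps, 0 < delta &
    forall n (C : 'I_r -> {set {set 'I_n}}), (n0 <= n)%N ->
    (forall i, mass (emb_weight H R) (C i) < eps * n%:R ^+ #|V|) ->
    delta * n%:R ^+ 2 <= #|uncovered C|%:R].
Proof.
move=> r0; have [m ram] := ramsey_embedding V r0.
pose mm : R := m.+2%:R; pose rr : R := r%:R.
have mm0 : 0 < mm by rewrite ltr0n.
have rr0 : 0 < rr by rewrite ltr0n.
(* Each constant limits one kind of map to a quarter of all: [eps] those containing an embedding,
   over all colours and placements, [delta] those hitting an uncovered pair, and the bound on n
   those with a collision. *)
exists (4 * mm ^+ #|V| * rr)^-1, (8 * mm ^+ 2)^-1, (4 * m.+2 ^ 2).+1.
split; first by rewrite invr_gt0 !mulr_gt0 // exprn_gt0.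
  by rewrite invr_gt0 mulr_gt0 // exprn_gt0.
move=> n C ltn few; rewrite leNgt; apply/negP => ltU.
have n0 : 0 < n%:R :> R by rewrite ltr0n; apply: leq_trans ltn.
pose M := [set z : 'I_n * 'I_n | (z.1 == z.2) || ([set z.1; z.2] \in uncovered C)].
have cardM : (#|M| <= n + 2 * #|uncovered C|)%N.
  apply: (@leq_trans (#|[set (x, x) | x : 'I_n]|
     + #|[set z : 'I_n * 'I_n | [set z.1; z.2] \in uncovered C & z.1 != z.2]|)%N).
    apply: leq_trans (leq_card_setU _ _); apply: subset_leq_card; apply/subsetP => -[x y].
    rewrite !inE /=; case: (eqVneq x y) => [->|neq] /=; first by rewrite imset_f.
    by move=> ->; rewrite orbT.
  apply: leq_add (card_pair_fibre _); apply: leq_trans (leq_imset_card _ _) _.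
  by rewrite card_ord.
pose bad := [set g : {ffun 'I_m.+2 -> 'I_n} | [exists x, exists y, (x != y) && ((g x, g y) \in M)]].
have card_bad : (#|bad| <= m.+2 ^ 2 * (#|M| * n ^ (m)))%N.
  pose F (p : ('I_m.+2 * 'I_m.+2) * ('I_n * 'I_n)) := [set g : {ffun 'I_m.+2 -> 'I_n} |
    (g p.1.1 == p.2.1) && (g p.1.2 == p.2.2)].
  pose P (p : ('I_m.+2 * 'I_m.+2) * ('I_n * 'I_n)) := (p.1.1 != p.1.2) && (p.2 \in M).
  apply: (@leq_trans (\sum_(p | P p) #|F p|)).
    apply: leq_card_family_cover => g; rewrite inE => /existsP[x /existsP[y /andP[neq gM]]].
    by exists ((x, y), (g x, g y)); rewrite ?inE ?eqxx // /P /= neq.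
  have leF p : P p -> (#|F p| <= n ^ m)%N.
    case: p => -[x y] [a b] /andP[/= neq _].
    have := @card_ffun_constrained _ _ [set x; y] (fun z => if z == x then [set a] else [set b]) 1.
    rewrite exp1n mul1n cards2 neq !card_ord subn2 /= => le_n; apply: leq_trans (le_n _) => //=.
      apply: subset_leq_card; apply/subsetP => g; rewrite !inE /= => /andP[/eqP ga /eqP gb].
      apply/forall_inP => z; rewrite !inE => /orP[]/eqP->; first by rewrite eqxx inE ga.
      by rewrite eq_sym (negbTE neq) inE gb.
    by move=> z _; case: ifP; rewrite cards1.
  apply: leq_trans (leq_sum _ leF) _; rewrite sum_nat_const mulnA leq_mul2r; apply/orP; right.
  have -> : (m.+2 ^ 2 * #|M| = #|setX [set: 'I_m.+2 * 'I_m.+2] M|)%N.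
    by rewrite cardsX cardsT card_prod !card_ord mulnn.
  apply: subset_leq_card; apply/subsetP => -[p p'].
  by rewrite unfold_in => /andP[_ pM]; rewrite in_setX in_setT.
have card_good : (#|~: bad| <= \sum_(ih : 'I_r * {ffun V -> 'I_m.+2} | injectiveb ih.2)
    #|embeddings H (C ih.1)| * n ^ (m.+2 - #|V|))%N.
  pose F (ih : 'I_r * {ffun V -> 'I_m.+2}) := [set g : {ffun 'I_m.+2 -> 'I_n} |
    [ffun x => g (ih.2 x)] \in embeddings H (C ih.1)].
  apply: (@leq_trans (\sum_(ih : 'I_r * {ffun V -> 'I_m.+2} | injectiveb ih.2) #|F ih|)).
    apply: leq_card_family_cover => g; rewrite !inE negb_exists => /forallP good.
    have good2 x y : x != y -> (g x != g y) && [exists i, [set g x; g y] \in C i].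
      move=> neq; have := good x; rewrite negb_exists => /forallP/(_ y).
      rewrite neq /= !inE /= negb_or cards2 => /andP[gxy]; rewrite gxy eqxx andbT negbK.
      by move=> /bigcupP[i _ iC]; apply/existsP; exists i.
    pose i0 := Ordinal r0.
    (* For x != y a good map always offers a colour, so the default can only occur on the diagonal,
       where nothing is asked. *)
    pose c x y := odflt i0 [pick i | [set g x; g y] \in C i].
    have csym x y : c x y = c y x by rewrite /c setUC.
    have [i [h [h_inj ch]]] := ram c csym.
    exists (i, h); first exact/injectiveP.
    rewrite !inE /=; apply/andP; split.
      apply/injectiveP => x y; rewrite !ffunE => gxy; apply/eqP.
      apply: contraTT isT => neq; have neqh : h x != h y by apply: contra neq => /eqP/h_inj->.
      by have := good2 _ _ neqh; rewrite gxy eqxx.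
    apply/subsetP => _ /imsetP[e eH ->].
    have /cards2P[x [y [neq ->]]] : #|e| == 2%N by rewrite (card_edge eH).
    rewrite imsetU1 imset_set1 !ffunE.
    have neqh : h x != h y by apply: contra neq => /eqP/h_inj->.
    have /andP[_ /existsP[j jC]] := good2 _ _ neqh.
    have := ch x y neq; rewrite /c; case: pickP => [i' iC /= <- //|/(_ j)].
    by rewrite jC.
  apply: leq_sum => -[i h] /injectiveP /= h_inj.
  pose G (f : {ffun V -> 'I_n}) := [set g : {ffun 'I_m.+2 -> 'I_n} | [ffun x => g (h x)] == f].
  apply: (@leq_trans (\sum_(f in embeddings H (C i)) #|G f|)).
    apply: leq_card_family_cover => g; rewrite inE /= => gE.
    by exists [ffun x => g (h x)]; [exact: gE | rewrite inE].
  rewrite -sum_nat_const; apply: leq_sum => f _.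
  have := @card_ffun_constrained _ _ [set h x | x in V] 
    (fun z => [set f x | x in V & h x == z]) 1.
  rewrite exp1n mul1n (card_imset _ h_inj) !card_ord => le_n; apply: leq_trans (le_n _) => //=.
    apply: subset_leq_card; apply/subsetP => g; rewrite !inE => /eqP gf.
    apply/forall_inP => _ /imsetP[x _ ->]; apply/imsetP; exists x; rewrite ?inE ?eqxx //.
    by rewrite -gf ffunE.
  move=> _ /imsetP[x _ ->]; rewrite -(cards1 (f x)); apply: subset_leq_card.
  by apply/subsetP => _ /imsetP[y + ->]; rewrite !inE /= => /eqP/h_inj->.
have tot : (n ^ m.+2 = #|bad| + #|~: bad|)%N by rewrite cardsC card_ffun !card_ord.
pose x : R := n%:R; pose X : R := x ^+ m.+2.
have X0 : 0 < X by apply: exprn_gt0.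
have bad_lt : #|bad|%:R <= X / 2.
  have xbig : 4 * mm ^+ 2 * x <= x ^+ 2.
    by rewrite [x ^+ 2]expr2 ler_pM2r // /mm -natrX -natrM ler_nat ltnW.
  have Msmall : mm ^+ 2 * #|M|%:R <= x ^+ 2 / 2.
    have mm20 : 0 < mm ^+ 2 by apply: exprn_gt0.
    have : #|M|%:R <= x + 2 * #|uncovered C|%:R by rewrite -natrM -natrD ler_nat.
    rewrite -(ler_pM2l mm20) => H1.
    have : mm ^+ 2 * #|uncovered C|%:R <= x ^+ 2 / 8.
      have -> : x ^+ 2 / 8 = mm ^+ 2 * ((8 * mm ^+ 2)^-1 * x ^+ 2).
        by move: (mm ^+ 2) mm20 => y y0; field; rewrite gt_eqF.
      by rewrite ler_pM2l // ltW.
    lra.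
  apply: (@le_trans _ _ (mm ^+ 2 * #|M|%:R * x ^+ m)).
    by rewrite /mm /x -!natrX -!natrM ler_nat -mulnA.
  have -> : X / 2 = x ^+ 2 / 2 * x ^+ m by rewrite /X -[m.+2]addn2 exprD; ring.
  by rewrite ler_wpM2r // exprn_ge0 // ltW.
have good_le : #|~: bad|%:R <= X / 4.
  apply: (@le_trans _ _ (\sum_(ih : 'I_r * {ffun V -> 'I_m.+2} | injectiveb ih.2)
       (4 * mm ^+ #|V| * rr)^-1 * X)).
    move: card_good; rewrite -(ler_nat R) natr_sum => /le_trans; apply.
    apply: ler_sum => -[i h] /injectiveP /= h_inj; rewrite natrM natrX.
    have leV : (#|V| <= m.+2)%N by have := leq_card h h_inj; rewrite card_ord.
    have -> : X = x ^+ #|V| * x ^+ (m.+2 - #|V|) by rewrite -exprD subnKC.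
    rewrite [leRHS]mulrA; apply: ler_wpM2r.
      by rewrite exprn_ge0 // ltW.
    by rewrite -mass_emb_weight; apply: ltW.
  rewrite big_mkcond; apply: (@le_trans _ _ (\sum_(ih : 'I_r * {ffun V -> 'I_m.+2})
       (4 * mm ^+ #|V| * rr)^-1 * X)).
    apply: ler_sum => ih _; case: ifP => // _; apply: mulr_ge0; last exact: ltW.
    by rewrite invr_ge0 ltW // !mulr_gt0 // exprn_gt0.
  rewrite sumr_const card_prod card_ffun !card_ord -[leLHS]mulr_natl natrM natrX -/mm -/rr.
  have : 0 < mm ^+ #|V| by apply: exprn_gt0.
  move: {few} (mm ^+ #|V|) (rr) rr0 => y z z0 y0; rewrite le_eqVlt; apply/orP; left; apply/eqP; field.
  by rewrite !gt_eqF.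
have : X = #|bad|%:R + #|~: bad|%:R by rewrite -natrD -tot natrX.
lra.
Qed.

End Supersaturation.

(** * The binomial random graph *)

Lemma sum_subset_prod (R : comPzRingType) (T : finType) (S : {set T}) (a b : T -> R) :
  \sum_(E : {set T} | E \subset S) \prod_(e in S) (if e \in E then a e else b e)
  = \prod_(e in S) (a e + b e).
Proof.
(* With 0 and 1 outside [S], the subsets not contained in [S] drop out of the full expansion. *)
pose a' e := if e \in S then a e else 0; pose b' e := if e \in S then b e else 1.
have -> : \prod_(e in S) (a e + b e) = \prod_e (a' e + b' e).
  rewrite big_mkcond; apply: eq_bigr => e _; rewrite /a' /b'.
  by case: ifP => _; rewrite ?add0r.
rewrite bigA_distr big_mkcond; apply: eq_bigr => E _; case: ifP => [sES|].
  rewrite big_mkcond; apply: eq_bigr => e _; rewrite /a' /b'.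
  by case: (boolP (e \in S)) => // eS; rewrite (contraNF (subsetP sES e)).
move/negbT/subsetPn => [e eE eS]; rewrite (bigD1 e) //= eE /a' (negbTE eS) mul0r //.
Qed.

Section RandomGraph.
Variables (R : realType) (n : nat) (p : R).
Hypothesis p01 : 0 <= p <= 1.
Implicit Types (G : sgraph 'I_n) (E U C S : {set {set 'I_n}}).

Let p0 : 0 <= p. Proof. by case/andP: p01. Qed.
Let p1 : p <= 1. Proof. by case/andP: p01. Qed.

Lemma edges_sub_pairs G : edges G \subset pairs n.
Proof. by apply/subsetP => e eG; rewrite inE (card_edge eG). Qed.

Lemma sum_sgraph (F : {set {set 'I_n}} -> R) :
  \sum_(G : sgraph 'I_n) F (edges G) = \sum_(E : {set {set 'I_n}} | E \subset pairs n) F E.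
Proof.
rewrite [RHS](reindex_omap (fun G : sgraph 'I_n => edges G) (fun E => insub E)) /=.
  by apply: eq_bigl => G; rewrite edges_sub_pairs valK eqxx.
move=> E sE; case: insubP => [G _ <- //|]; case/negP; apply/forall_inP => e /(subsetP sE).
by rewrite inE.
Qed.

Lemma Gnp_massE G :
  Gnp_mass p G = \prod_(e in pairs n) (if e \in edges G then p else 1 - p).
Proof. by apply: eq_bigl => e; rewrite inE. Qed.

Lemma Gnp_mass_ge0 G : 0 <= Gnp_mass p G.
Proof. by apply: prodr_ge0 => e _; case: ifP => _; rewrite ?subr_ge0. Qed.

Lemma Gnp_prob_interval U C : U \subset pairs n -> U \subset C ->
  Gnp_prob p (fun G => (U \subset edges G) && (edges G \subset C))
  = p ^+ #|U| * (1 - p) ^+ #|pairs n :\: C|.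
Proof.
move=> sUS sUC; rewrite /Gnp_prob big_mkcond /=.
(* The event is folded into the factors: one of them vanishes when an edge lies outside [C] or an
   element of [U] is missing. *)
pose a (e : {set 'I_n}) := if e \in C then p else 0.
pose b (e : {set 'I_n}) := if e \in U then 0 else 1 - p.
transitivity (\sum_(G : sgraph 'I_n)
    \prod_(e in pairs n) (if e \in edges G then a e else b e)).
  apply: eq_bigr => G _; rewrite Gnp_massE; case: ifP => [/andP[sUG sGC]|].
    apply: eq_bigr => e _; rewrite /a /b; case: (boolP (e \in edges G)) => eG.
      by rewrite (subsetP sGC).
    by rewrite (contraNF (subsetP sUG e)).
  move/negbT; rewrite negb_and => /orP[]/subsetPn[e e1 e2]; apply/esym.
    by rewrite (bigD1 e) ?(subsetP sUS) //= (negbTE e2) /b e1 mul0r.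
  rewrite (bigD1 e) ?(subsetP (edges_sub_pairs G)) //= e1 /a (negbTE e2) mul0r //.
rewrite (sum_sgraph (fun E => \prod_(e in pairs n) (if e \in E then a e else b e))).
rewrite sum_subset_prod.
rewrite (eq_bigr (fun e =>
  (if e \in U then p else 1) * (if e \in C then 1 else 1 - p))); last first.
  move=> e _; rewrite /a /b; case: (boolP (e \in U)) => eU.
    by rewrite (subsetP sUC) // addr0 mulr1.
  by case: ifP => _; rewrite mul1r ?add0r // addrC subrK.
rewrite big_split /=; congr (_ * _).
  rewrite -big_mkcondr /= -prodr_const; apply: eq_bigl => e.
  by case: (boolP (e \in U)) => eU; rewrite ?andbF // (subsetP sUS).
rewrite (eq_bigr (fun e => if e \notin C then 1 - p else 1)); last by move=> e _; case: ifP.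
by rewrite -big_mkcondr /= -prodr_const; apply: eq_bigl => e; rewrite in_setD andbC.
Qed.

Lemma Gnp_prob_sup U : U \subset pairs n ->
  Gnp_prob p (fun G => U \subset edges G) = p ^+ #|U|.
Proof.
move=> sU; have := Gnp_prob_interval sU (subsetT U); rewrite setDT cards0 expr0 mulr1 => <-.
by apply: eq_bigl => G; rewrite subsetT andbT.
Qed.

Lemma Gnp_mass_sum : \sum_(G : sgraph 'I_n) Gnp_mass p G = 1.
Proof.
have := Gnp_prob_sup (sub0set _); rewrite cards0 expr0 => <-.
by apply: eq_bigl => G; rewrite sub0set.
Qed.

Lemma Gnp_prob_compl (A : pred (sgraph 'I_n)) :
  Gnp_prob p A = 1 - Gnp_prob p (fun G => ~~ A G).
Proof. by rewrite -Gnp_mass_sum (bigID A) /= addrK. Qed.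

Lemma Gnp_prob_le1 (A : pred (sgraph 'I_n)) : Gnp_prob p A <= 1.
Proof.
by rewrite Gnp_prob_compl lerBlDr lerDl sumr_ge0 // => G _; apply: Gnp_mass_ge0.
Qed.

Lemma Gnp_prob_subset (A B : pred (sgraph 'I_n)) : (forall G, A G -> B G) ->
  Gnp_prob p A <= Gnp_prob p B.
Proof.
move=> sAB; rewrite /Gnp_prob [leLHS]big_mkcond [leRHS]big_mkcond; apply: ler_sum => G _.
by case: ifP => [/sAB->//|_]; case: ifP => // _; apply: Gnp_mass_ge0.
Qed.

Lemma Gnp_prob_union (A B : pred (sgraph 'I_n)) :
  Gnp_prob p (fun G => A G || B G) <= Gnp_prob p A + Gnp_prob p B.
Proof.
rewrite /Gnp_prob [leLHS]big_mkcond [X in _ <= X + _]big_mkcond [X in _ <= _ + X]big_mkcond.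
rewrite -big_split; apply: ler_sum => G _ /=.
by have := Gnp_mass_ge0 G; case: (A G); case: (B G) => /=; lra.
Qed.

Lemma Gnp_prob_bigunion (I : finType) (A : I -> pred (sgraph 'I_n)) (P : pred I) :
  Gnp_prob p (fun G => [exists i, P i && A i G]) <= \sum_(i | P i) Gnp_prob p (A i).
Proof.
rewrite /Gnp_prob [leRHS](eq_bigr (fun i => \sum_G (if A i G then Gnp_mass p G else 0))); last first.
  by move=> i _; rewrite big_mkcond.
rewrite exchange_big [leLHS]big_mkcond; apply: ler_sum => G _ /=.
have m0 i : 0 <= (if A i G then Gnp_mass p G else 0).
  by case: ifP => // _; apply: Gnp_mass_ge0.
case: ifP => [/existsP[i /andP[Pi Ai]]|_]; last by apply: sumr_ge0.
by rewrite (bigD1 i) //= Ai lerDl sumr_ge0.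
Qed.

Definition Gnp_expect (F : sgraph 'I_n -> R) := \sum_(G : sgraph 'I_n) Gnp_mass p G * F G.

(** * Second moment of the weight spanned by the random graph *)

Section SecondMoment.
Variables (k : nat) (w : {set {set 'I_n}} -> R) (K M : R).
Hypotheses (w0 : weight w) (wk : uniform w k (pairs n)).
Hypotheses (K0 : 0 <= K) (M0 : 0 <= M).
Hypothesis w_deg : forall B, B != set0 -> deg w B <= K * (p ^+ #|B|.-1 * M).

Let W := mass w (pairs n).
Let WE : W = \sum_A w A.
Proof. by rewrite /W (mass_uniform wk); apply: eq_bigl => A; rewrite sub0set. Qed.

Lemma expect_sup A : w A != 0 -> forall B, w B != 0 ->
  \sum_(G : sgraph 'I_n) Gnp_mass p G * (A \subset edges G)%:R * (B \subset edges G)%:R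
  = p ^+ #|A :|: B|.
Proof.
move=> /wk[_ sA] B /wk[_ sB]; rewrite -Gnp_prob_sup ?subUset ?sA //.
rewrite /Gnp_prob [RHS]big_mkcond; apply: eq_bigr => G _.
by rewrite subUset -mulrA -natrM mulnb; case: ifP => _; rewrite ?mulr1 ?mulr0.
Qed.

Lemma mass_indicator C : mass w C = \sum_A w A * (A \subset C)%:R.
Proof.
by rewrite /mass big_mkcond; apply: eq_bigr => A _; case: ifP => _; rewrite ?mulr1 ?mulr0.
Qed.

Lemma expect_mass : Gnp_expect (fun G => mass w (edges G)) = W * p ^+ k.
Proof.
rewrite /Gnp_expect; under eq_bigr do rewrite mass_indicator mulr_sumr.
rewrite exchange_big /= WE mulr_suml; apply: eq_bigr => A _.
have [->|nz] := eqVneq (w A) 0.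
  by rewrite mul0r big1 // => G _; rewrite mul0r mulr0.
have [cA _] := wk nz; have -> : p ^+ k = p ^+ #|A :|: A| by rewrite setUid cA.
rewrite -(expect_sup nz nz) mulr_sumr.
apply: eq_bigr => G _; rewrite -[in RHS]mulrA -natrM mulnb andbb; ring.
Qed.

(** Disjoint pairs are paid by the squared mean; an intersecting pair is charged to its intersection
    [D]. The degree bound at [D] times p^(2k - |D|) is K p^(2k-1) M, whatever the size of [D]. *)
Lemma expect_mass_sq : Gnp_expect (fun G => mass w (edges G) ^+ 2) <=
  (W * p ^+ k) ^+ 2 + W * (2 ^+ k * (K * (p ^+ (2 * k).-1 * M))).
Proof.
have -> : Gnp_expect (fun G => mass w (edges G) ^+ 2)
   = \sum_A \sum_B w A * w B * p ^+ #|A :|: B|.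
  rewrite /Gnp_expect; under eq_bigr do rewrite expr2 mass_indicator big_distrlr /= mulr_sumr.
  rewrite exchange_big; apply: eq_bigr => A _ /=.
  under eq_bigr do rewrite mulr_sumr.
  rewrite exchange_big; apply: eq_bigr => B _ /=.
  have [->|nzA] := eqVneq (w A) 0; first by rewrite !mul0r big1 // => G _; rewrite !mul0r mulr0.
  have [->|nzB] := eqVneq (w B) 0.
    by rewrite mulr0 mul0r big1 // => G _; rewrite mul0r !mulr0.
  rewrite -(expect_sup nzA nzB) mulr_sumr; apply: eq_bigr => G _; ring.
rewrite WE.
have -> : ((\sum_A w A) * p ^+ k) ^+ 2 = \sum_A \sum_B w A * w B * (p ^+ k) ^+ 2.
  rewrite exprMn expr2 big_distrlr /= mulr_suml; apply: eq_bigr => A _.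
  by rewrite mulr_suml.
rewrite mulr_suml -big_split /=; apply: ler_sum => A _.
have [->|nzA] := eqVneq (w A) 0.
  by rewrite mul0r addr0; apply: ler_sum => B _; rewrite !mul0r.
have [cA sA] := wk nzA.
(* Only [D = A :&: B] is needed; allowing every nonempty [D] inside [A] makes the sum over [B] a
   degree and costs a factor 2^k. *)
have le1 B : w A * w B * p ^+ #|A :|: B| <= w A * w B * (p ^+ k) ^+ 2 +
   w A * \sum_(D : {set {set 'I_n}} | (D \subset A) && (D != set0))
           (if D \subset B then w B * p ^+ (2 * k - #|D|) else 0).
  have [->|nzB] := eqVneq (w B) 0.
    rewrite mulr0 !mul0r add0r mulr_ge0 // sumr_ge0 // => D _.
    by rewrite mul0r; case: ifP.
  have [cB _] := wk nzB.
  have cU : #|A :|: B| = (2 * k - #|A :&: B|)%N by rewrite cardsU cA cB mul2n addnn.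
  rewrite cU -mulrA -[in X in _ <= X + _]mulrA -mulrDr; apply: ler_wpM2l => //.
  have [AB0|AB] := eqVneq (A :&: B) set0.
    rewrite AB0 cards0 subn0 -exprM mulnC lerDl sumr_ge0 // => D _.
    by case: ifP => // _; rewrite mulr_ge0 // exprn_ge0.
  rewrite (bigD1 (A :&: B)) ?subsetIl ?AB //= subsetIr addrCA lerDl addr_ge0 //.
    by rewrite mulr_ge0 // exprn_ge0 // exprn_ge0.
  by apply: sumr_ge0 => D _; case: ifP => // _; rewrite mulr_ge0 // exprn_ge0.
apply: le_trans (ler_sum _ (fun B _ => le1 B)) _.
rewrite big_split /= lerD2l -mulr_sumr; apply: ler_wpM2l => //.
rewrite exchange_big /=.
apply: (@le_trans _ _ (\sum_(D : {set {set 'I_n}} | (D \subset A) && (D != set0))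
   K * (p ^+ (2 * k).-1 * M))).
  apply: ler_sum => D /andP[sDA nD].
  rewrite -big_mkcond /= -mulr_suml -/(deg w D).
  have cD : (0 < #|D| <= k)%N by rewrite card_gt0 nD -cA subset_leq_card.
  apply: (@le_trans _ _ (K * (p ^+ #|D|.-1 * M) * p ^+ (2 * k - #|D|))).
    by apply: ler_wpM2r; [apply: exprn_ge0 | apply: w_deg].
  have -> : (2 * k).-1 = (#|D|.-1 + (2 * k - #|D|))%N.
    case/andP: cD; case: #|D| => // d _ dk.
    by rewrite -[in LHS](@subnKC d.+1 (2 * k)) // (leq_trans dk) // leq_pmull.
  rewrite exprD; move: (p ^+ #|D|.-1) (p ^+ (2 * k - #|D|)) => y z.
  by have -> : K * (y * M) * z = K * (y * z * M) by ring.
rewrite sumr_const -[leLHS]mulr_natl; apply: ler_wpM2r.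
  by rewrite !mulr_ge0 // exprn_ge0.
rewrite -cA -natrX -card_powerset ler_nat; apply: subset_leq_card; apply/subsetP => D.
by rewrite unfold_in powersetE => /andP[].
Qed.

Lemma mass_upper_tail a : 0 < a ->
  Gnp_prob p (fun G => W * p ^+ k + a <= mass w (edges G)) <=
  W * (2 ^+ k * (K * (p ^+ (2 * k).-1 * M))) / a ^+ 2.
Proof.
move=> a0; set mu := W * p ^+ k; set v := W * _.
rewrite ler_pdivlMr ?exprn_gt0 //.
have var : Gnp_expect (fun G => (mass w (edges G) - mu) ^+ 2) <= v.
  have -> : Gnp_expect (fun G => (mass w (edges G) - mu) ^+ 2) =
    Gnp_expect (fun G => mass w (edges G) ^+ 2)
    - 2 * mu * Gnp_expect (fun G => mass w (edges G))
    + mu ^+ 2 * \sum_(G : sgraph 'I_n) Gnp_mass p G.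
    rewrite /Gnp_expect !mulr_sumr -sumrB -big_split; apply: eq_bigr => G _ /=; ring.
  by rewrite Gnp_mass_sum expect_mass -/mu; have := expect_mass_sq; rewrite -/mu -/v; lra.
apply: le_trans var; rewrite /Gnp_prob big_mkcond mulr_suml; apply: ler_sum => G _.
case: ifP => [le_a|_]; last by rewrite mul0r mulr_ge0 ?Gnp_mass_ge0 ?sqr_ge0.
by apply: ler_wpM2l; rewrite ?Gnp_mass_ge0 // ler_sqr ?nnegrE; lra.
Qed.

End SecondMoment.

(** * Union bound over fingerprints *)

Section UnionBound.
Variables (r : nat) (C : {set {set 'I_n}} -> {set {set 'I_n}}).
Implicit Type kappa : {ffun {set 'I_n} -> option 'I_r}.

(** The [r] fingerprints are disjoint, so they are stored as one partial colouring; summing over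
    these factors pair by pair. *)
Definition colour_class kappa i := [set x | kappa x == Some i].
Definition coloured kappa := [set x | kappa x != None].
Definition covered kappa := \bigcup_i C (colour_class kappa i).

(* The factor expR (a * (t - #|coloured kappa|)) >= 1 turns the sum over small
   fingerprints into a full product over the pairs. *)
Lemma fingerprint_union_bound (a t m : R) : 0 <= a ->
  Gnp_prob p (fun G => [exists kappa,
      [&& #|coloured kappa|%:R <= t, m <= #|pairs n :\: covered kappa|%:R,
          coloured kappa \subset pairs n & coloured kappa \subset covered kappa] &&
      ((coloured kappa \subset edges G) && (edges G \subset covered kappa))])
  <= expR (a * t + r%:R * p * expR (- a) * #|pairs n|%:R - p * m).
Proof.
move=> a0; apply: le_trans (Gnp_prob_bigunion _ _) _.
pose z := expR (- a).
have z0 : 0 < z by apply: expR_gt0.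
(* Factor 1 for an uncoloured set and p exp(-a) for each colour on a pair. A coloured set that is
   not a pair gets 0, so only the pairs matter in the product. *)
pose F (x : {set 'I_n}) (o : option 'I_r) : R :=
  if o is None then 1 else if x \in pairs n then p * z else 0.
apply: (@le_trans _ _ (\sum_(kappa : {ffun {set 'I_n} -> option 'I_r})
    expR (a * t - p * m) * \prod_x F x (kappa x))).
  rewrite big_mkcond; apply: ler_sum => kappa _; case: ifP => [/and4P[le_t le_m sP sC]|_].
    rewrite Gnp_prob_interval //.
    have -> : \prod_x F x (kappa x) = (p * z) ^+ #|coloured kappa|.
      rewrite -prodr_const [RHS]big_mkcond; apply: eq_bigr => x _.
      rewrite inE /F; case E: (kappa x) => [i|] //=.
      by rewrite (subsetP sP) // inE E.
    rewrite exprMn [leRHS]mulrCA; apply: ler_wpM2l; first exact: exprn_ge0.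
    rewrite -expRM_natl -expRD.
    apply: (@le_trans _ _ (expR (- p * #|pairs n :\: covered kappa|%:R))).
      rewrite mulrC expRM_natl; apply: lerXn2r; rewrite ?nnegrE ?subr_ge0 ?expR_ge0 //.
      exact: expR_ge1Dx.
    rewrite ler_expR.
    have : p * m <= p * #|pairs n :\: covered kappa|%:R by apply: ler_wpM2l.
    have : a * #|coloured kappa|%:R <= a * t by apply: ler_wpM2l.
    lra.
  rewrite mulr_ge0 ?expR_ge0 // prodr_ge0 // => x _; rewrite /F.
  by case: (kappa x) => // i; case: ifP => // _; rewrite mulr_ge0 // ltW.
rewrite -mulr_sumr -(bigA_distr_bigA F).
have -> : a * t + r%:R * p * z * #|pairs n|%:R - p * m =
   (a * t - p * m) + #|pairs n|%:R * (r%:R * (p * z)) by ring.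
rewrite [leRHS]expRD; apply: ler_wpM2l; first exact: expR_ge0.
rewrite expRM_natl -prodr_const [leRHS]big_mkcond; apply: ler_prod => x _.
have pz0 : 0 <= p * z by rewrite mulr_ge0 // ltW.
have -> : \sum_o F x o = 1 + r%:R * (if x \in pairs n then p * z else 0).
  rewrite (bigD1 None) //=; congr (_ + _); rewrite (eq_bigr (fun=> if x \in pairs n then p * z else 0)).
    by rewrite sumr_const cardC1 card_option card_ord mulr_natl.
  by case.
case: ifP => _; last by rewrite mulr0 addr0 ler01 lexx.
by rewrite expR_ge1Dx andbT addr_ge0 // mulr_ge0.
Qed.

End UnionBound.
End RandomGraph.

(** * Embeddings, copies and the density m2 *)

Section GraphParameters.
Variables (R : realType) (V : finType) (H : sgraph V).

Lemma card_cover_edges (J : {set {set V}}) : J \subset edges H -> J != set0 ->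
  (2 <= #|cover J|)%N.
Proof.
move=> sJ /set0Pn[e eJ]; rewrite -(card_edge (subsetP sJ _ eJ)).
by apply: subset_leq_card; apply: (bigcup_sup e).
Qed.

Lemma card_cover_edges_gt2 (J : {set {set V}}) : J \subset edges H -> (1 < #|J|)%N ->
  (2 < #|cover J|)%N.
Proof.
move=> sJ /card_gt1P[e [e' [eJ e'J neq]]].
rewrite ltn_neqAle eq_sym (card_cover_edges sJ) ?andbT; last by apply/set0Pn; exists e.
apply: contra neq => /eqP c2.
have E (d : {set V}) : d \in J -> d = cover J.
  move=> dJ; apply/eqP; rewrite eqEcard c2 (card_edge (subsetP sJ _ dJ)) leqnn andbT.
  exact: (bigcup_sup d).
by rewrite (E e) // (E e').
Qed.

(** Two edges cover at least three vertices, so the exceptional clause of [d2] does not apply and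
    the denominator is positive. *)
Lemma d2_le_m2 (J : {set {set V}}) : J \subset edges H -> (1 < #|J|)%N ->
  #|J|%:R - 1 <= m2 R H * (#|cover J|%:R - 2).
Proof.
move=> sJ J2; have c3 := card_cover_edges_gt2 sJ J2.
have c0 : 0 < #|cover J|%:R - 2 :> R by rewrite subr_gt0 ltr_nat.
rewrite -ler_pdivrMr //.
have <- : d2 R (cover J, J) = (#|J|%:R - 1) / (#|cover J|%:R - 2).
  by rewrite /d2 /= gtn_eqF.
rewrite /m2; apply: le_bigmax_cond.
rewrite inE /= sJ /= (ltnW J2) andbT; apply/forall_inP => e eJ; exact: (bigcup_sup e).
Qed.

Hypothesis hH : (2 <= maxdeg H)%N.

(** The path with two edges has [d2] equal to 1; it is the source of [m2 >= 1] and hence of p n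
    being bounded below. *)
Lemma maxdeg_cherry : exists J : {set {set V}},
  [/\ J \subset edges H, #|J| = 2%N & (#|cover J| <= 3)%N].
Proof.
have /existsP[v] : [exists v : V, 2 <= #|[set e in edges H | v \in e]|]%N.
  apply: contraTT hH; rewrite negb_exists -ltnNge ltnS => /forallP le1.
  by apply/bigmax_leqP => v _; have := le1 v; rewrite -ltnNge.
move=> /card_gt1P[e [e' []]]; rewrite !inE => /andP[eH ve] /andP[e'H ve'] neq.
exists [set e; e']; split; first by rewrite subUset !sub1set eH.
  by rewrite cards2 neq.
rewrite /cover bigcup_setU !big_set1 cardsU (card_edge eH) (card_edge e'H).
have : (0 < #|e :&: e'|)%N by apply/card_gt0P; exists v; rewrite inE ve.
by case: #|e :&: e'| => // m _; rewrite subSS leq_subr.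
Qed.

Lemma m2_ge1 : 1 <= m2 R H.
Proof.
have [J [sJ J2 c3]] := maxdeg_cherry.
have := d2_le_m2 sJ; rewrite J2 => /(_ isT) le1.
have := card_cover_edges_gt2 sJ; rewrite J2 => /(_ isT) c2.
have cE : #|cover J| = 3%N by apply/eqP; rewrite eqn_leq c3.
by move: le1; rewrite cE; lra.
Qed.

Lemma card_edges_gt0 : (0 < #|edges H|)%N.
Proof.
have [J [sJ J2 _]] := maxdeg_cherry.
by apply: leq_trans (subset_leq_card sJ); rewrite J2.
Qed.

Lemma card_vertices_ge2 : (2 <= #|V|)%N.
Proof.
have [J [sJ J2 _]] := maxdeg_cherry; apply: leq_trans (max_card (cover J)).
by apply: card_cover_edges sJ _; rewrite -card_gt0 J2.
Qed.

(** The role of m2: at density [q] a fixed pair is expected to lie in at least a constant number of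
    copies of each [J]. For a single edge both exponents of [q] and of the claim degenerate, hence
    the separate case. *)
Lemma subgraph_expectation (n : nat) (q : R) (J : {set {set V}}) : (0 < n)%N ->
    n%:R `^ (- (1 / m2 R H)) <= q -> J \subset edges H -> J != set0 ->
  1 <= n%:R ^+ (#|cover J| - 2) * q ^+ #|J|.-1.
Proof.
move=> n0 leq sJ nJ; have := nJ; rewrite -card_gt0; case E: #|J| => [//|[|j]] _ /=.
  by rewrite expr0 mulr1 exprn_ege1 // ler1n.
have J2 : (1 < #|J|)%N by rewrite E.
have c3 := card_cover_edges_gt2 sJ J2.
have m1 := m2_ge1; have nr : 1 <= n%:R :> R by rewrite ler1n.
have n0' : 0 < n%:R :> R by apply: lt_le_trans nr.
have := d2_le_m2 sJ J2; rewrite E -addn2 natrD => le1.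
apply: (@le_trans _ _ (n%:R `^ (#|cover J|%:R - 2) * (n%:R `^ (- (1 / m2 R H))) ^+ j.+1)).
  rewrite -powR_mulrn ?powR_ge0 // -powRrM -powRD ?(gt_eqF n0') ?implybT //.
  rewrite -[leLHS](powRr0 n%:R) ler_powR //.
  have m0 : 0 < m2 R H by apply: lt_le_trans m1.
  rewrite mulNr subr_ge0 mul1r mulrC ler_pdivrMr // -natr1 mulrC; lra.
have -> : n%:R `^ (#|cover J|%:R - 2) = n%:R ^+ (#|cover J| - 2) :> R.
  by rewrite -powR_mulrn ?(ltW n0') // natrB // ltnW.
apply: ler_wpM2l; first by rewrite exprn_ge0 // ltW.
by apply: lerXn2r => //; rewrite nnegrE ?powR_ge0 // (le_trans (powR_ge0 _ _) leq).
Qed.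

Definition degree_const : R := (2 ^ #|edges H| * (2 * #|edges H|) ^ #|V|)%:R.

Lemma degree_const_ge1 : 1 <= degree_const.
Proof.
rewrite /degree_const ler1n muln_gt0 !expn_gt0 /= muln_gt0 /=.
by rewrite card_edges_gt0.
Qed.

(** Let [J] be the preimage of [B]. Vertices in [cover J] go to [cover B], with boundedly many
    choices, and the others are free; [subgraph_expectation] converts the resulting power of n into
    the claimed bound. The constant counts the sets [J] and the bounded choices. *)
Lemma deg_emb_weight_le (n : nat) (q : R) (B : {set {set 'I_n}}) : (0 < n)%N ->
    n%:R `^ (- (1 / m2 R H)) <= q -> B != set0 ->
  deg (emb_weight H R) B <= degree_const * (q ^+ #|B|.-1 * n%:R ^+ (#|V| - 2)).
Proof.
move=> n0 leq nB; rewrite deg_emb_weight; set S := [set f | _].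
have q0 : 0 <= q by apply: le_trans (powR_ge0 _ _) leq.
(* A witness [f0] shows that [B] consists of at most [#|edges H|] pairs, which bounds [cover B]. *)
have [->|[f0]] := set_0Vmem S.
  by rewrite cards0 !mulr_ge0 // exprn_ge0.
rewrite inE => /andP[/injectiveP/(@edge_imageP _ H)[cf sf] sBf].
have cB : (#|B| <= #|edges H|)%N by rewrite -cf subset_leq_card.
have ccB : (#|cover B| <= 2 * #|edges H|)%N.
  apply: leq_trans (leq_card_cover B) _.
  rewrite (eq_bigr (fun=> 2%N)) => [|e eB]; first by rewrite sum_nat_const mulnC leq_mul2l.
  by apply/eqP; have := subsetP sf _ (subsetP sBf _ eB); rewrite inE.
pose P (J : {set {set V}}) := (J \subset edges H) && (#|J| == #|B|).
pose F (J : {set {set V}}) := [set f : {ffun V -> 'I_n} | [forall x in cover J, f x \in cover B]].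
have leS : (#|S| <= \sum_(J | P J) #|F J|)%N.
  apply: leq_card_family_cover => f; rewrite inE => /andP[/injectiveP f_inj sB].
  pose J := [set e in edges H | f @: (e : {set V}) \in B].
  have imJ : [set f @: (e : {set V}) | e in J] = B.
    apply/setP => b; apply/imsetP/idP => [[e + ->]|bB]; first by rewrite inE => /andP[].
    have /imsetP[e eH eb] := subsetP sB _ bB.
    by exists e => //; rewrite inE eH -eb.
  exists J.
    rewrite /P -imJ card_imset ?eqxx ?andbT; last exact: imset_inj.
    by apply/subsetP => e; rewrite inE => /andP[].
  rewrite inE; apply/forall_inP => x /bigcupP[e eJ xe].
  apply/bigcupP; exists (f @: e); last exact: imset_f.
  by move: eJ; rewrite inE => /andP[].
apply: (@le_trans _ _ (\sum_(J | P J)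
   ((2 * #|edges H|) ^ #|V|)%:R * (q ^+ #|B|.-1 * n%:R ^+ (#|V| - 2)))).
  move: leS; rewrite -(ler_nat R) natr_sum => /le_trans; apply; apply: ler_sum => J.
  move=> /andP[sJ /eqP cJ].
  have nJ : J != set0 by rewrite -card_gt0 cJ card_gt0.
  have := @card_ffun_constrained V 'I_n (cover J) (fun=> cover B) (2 * #|edges H|) (fun _ _ => ccB).
  rewrite card_ord -(ler_nat R) natrM => /le_trans; apply; apply: ler_pM; rewrite ?ler0n //.
    by rewrite ler_nat leq_pexp2l ?max_card // muln_gt0 /= card_edges_gt0.
  have := subgraph_expectation n0 leq sJ nJ; rewrite cJ natrX => ge1.
  have c2 := card_cover_edges sJ nJ.
  have -> : n%:R ^+ (#|V| - 2) = n%:R ^+ (#|V| - #|cover J|) * n%:R ^+ (#|cover J| - 2) :> R.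
    by rewrite -exprD addnBA // subnK // max_card.
  rewrite mulrC -mulrA ler_peMr ?exprn_ge0 //.
rewrite sumr_const -[leLHS]mulr_natl /degree_const natrM -mulrA; apply: ler_wpM2r.
  by rewrite !mulr_ge0 // exprn_ge0.
rewrite ler_nat -card_powerset; apply: subset_leq_card; apply/subsetP => J.
by rewrite unfold_in powersetE => /andP[].
Qed.

End GraphParameters.

(** * Copies, embeddings and colour classes *)

Section Copies.
Variables (V : finType) (H : sgraph V) (n : nat) (G : sgraph 'I_n).

Definition copy_of (f : {ffun V -> 'I_n}) : vepair 'I_n :=
  ([set f x | x : V], edge_image H f).

Lemma copy_of_copies (f : {ffun V -> 'I_n}) :
  f \in embeddings H (edges G) -> copy_of f \in copies H G.
Proof.
rewrite inE => /andP[f_inj sf]; rewrite !inE /= sf /=; apply/andP; split.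
  apply/forall_inP => _ /imsetP[e _ ->]; apply/subsetP => _ /imsetP[x _ ->].
  exact: imset_f.
by apply/existsP; exists f; rewrite f_inj eqxx.
Qed.

Lemma card_copies_le : (#|copies H G| <= #|embeddings H (edges G)|)%N.
Proof.
apply: leq_trans (leq_imset_card copy_of _); apply: subset_leq_card.
apply/subsetP => J; rewrite !inE => /andP[/andP[sJ _] /existsP[f /andP[f_inj /eqP JE]]].
by apply/imsetP; exists f => //; rewrite inE f_inj; rewrite JE in sJ.
Qed.

Section Colouring.
Variables (r : nat) (c : {ffun {e : {set 'I_n} | e \in edges G} -> 'I_r}).

Definition edge_class i : {set {set 'I_n}} :=
  [set val e | e : {e : {set 'I_n} | e \in edges G} & c e == i].

Lemma edge_class_sub i : edge_class i \subset edges G.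
Proof. by apply/subsetP => _ /imsetP[e _ ->]; apply: valP. Qed.

(** An embedding into one class spans a monochromatic copy, and a copy has #|V| vertices, so at most
    #|V|^#|V| maps land in it. *)
Lemma card_embeddings_class i :
  (#|embeddings H (edge_class i)| <= #|V| ^ #|V| * #|mono_copies H c|)%N.
Proof.
pose F (J : vepair 'I_n) := [set f : {ffun V -> 'I_n} | [forall x in setT, f x \in J.1]].
apply: (@leq_trans (\sum_(J in mono_copies H c) #|[set f in F J | #|J.1| == #|V|]|)).
  apply: leq_card_family_cover => f; rewrite inE => /andP[/injectiveP f_inj sf].
  exists (copy_of f).
    rewrite inE copy_of_copies /=; last first.
      by rewrite inE (subset_trans sf (edge_class_sub i)) andbT; apply/injectiveP.
    apply/existsP; exists i; apply/forallP => e.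
    apply/implyP => /(subsetP sf)/imsetP[e' + /val_inj->].
    by rewrite inE.
  rewrite !inE /= card_imset // eqxx andbT; apply/forall_inP => x _; exact: imset_f.
rewrite mulnC -sum_nat_const; apply: leq_sum => J _.
have [cJ|ncJ] := boolP (#|J.1| == #|V|); last first.
  by rewrite (_ : [set f in _ | _] = set0) ?cards0 //; apply/setP => f; rewrite !inE andbF.
apply: (@leq_trans #|F J|); first by apply: subset_leq_card; apply/subsetP => f; rewrite inE => /andP[].
have := @card_ffun_constrained V 'I_n setT (fun=> J.1) #|V|; rewrite cardsT subnn expn0 muln1.
by apply => x _; rewrite (eqP cJ).
Qed.

Lemma card_mono_copies_le : (#|mono_copies H c| <= #|copies H G|)%N.
Proof. by apply: subset_leq_card; apply/subsetP => J; rewrite inE => /andP[]. Qed.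

End Colouring.

Lemma multiplicity_ge (r m : nat) : (0 < r)%N ->
  (forall c : {ffun {e : {set 'I_n} | e \in edges G} -> 'I_r}, (m <= #|mono_copies H c|)%N) ->
  (m <= multiplicity r H G)%N.
Proof.
move=> r0 le_m; rewrite /multiplicity; elim/big_ind: _ => // [|x y lx ly].
  apply: leq_trans (le_m [ffun=> Ordinal r0]) (card_mono_copies_le _).
by rewrite leq_min lx.
Qed.

Lemma multiplicity_le r : (multiplicity r H G <= #|copies H G|)%N.
Proof.
rewrite /multiplicity; elim/big_rec: _ => // c x _ lex.
exact: leq_trans (geq_minr _ _) lex.
Qed.

Lemma multiplicity1 : multiplicity 1 H G = #|copies H G|.
Proof.
apply/eqP; rewrite eqn_leq multiplicity_le multiplicity_ge // => c.
apply: subset_leq_card; apply/subsetP => J JH; rewrite inE JH /=.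
by apply/existsP; exists ord0; apply/forallP => e; rewrite [c e]ord1 eqxx implybT.
Qed.

End Copies.

(** * Robustness *)

Lemma card_pairs_le (n : nat) : (#|pairs n| <= n ^ 2)%N.
Proof.
apply: (@leq_trans #|[set [set z.1; z.2] | z : 'I_n * 'I_n]|).
  apply: subset_leq_card; apply/subsetP => e; rewrite inE => /cards2P[x [y [_ ->]]].
  by apply/imsetP; exists (x, y).
by apply: leq_trans (leq_imset_card _ _) _; rewrite card_prod !card_ord mulnn.
Qed.

(** Fingerprints lie inside disjoint colour classes, so the [pick] has at most one candidate and no
    fingerprint loses an element. *)
Lemma colouring_fingerprint (n r : nat) (G : sgraph 'I_n)
    (c : {ffun {e : {set 'I_n} | e \in edges G} -> 'I_r})
    (F C : {set {set 'I_n}} -> {set {set 'I_n}}) :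
    (forall I : {set {set 'I_n}}, I \subset pairs n -> F I \subset I /\ I \subset C (F I)) ->
  exists kappa : {ffun {set 'I_n} -> option 'I_r},
    [/\ forall i, colour_class kappa i = F (edge_class c i),
        coloured kappa \subset edges G & edges G \subset covered C kappa].
Proof.
move=> FC; have sP i : edge_class c i \subset pairs n.
  exact: subset_trans (edge_class_sub c i) (edges_sub_pairs G).
have sF i : F (edge_class c i) \subset edge_class c i by case: (FC _ (sP i)).
pose kappa : {ffun {set 'I_n} -> option 'I_r} := [ffun x => [pick i | x \in F (edge_class c i)]].
have classE i : colour_class kappa i = F (edge_class c i).
  apply/setP => x; rewrite inE ffunE; case: pickP => [j xj|none]; last by rewrite none.
  apply/eqP/idP => [[<-] //|xi]; congr Some.
  have /imsetP[e + xe] := subsetP (sF i) _ xi; rewrite inE => /eqP <-.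
  have /imsetP[e' + xe'] := subsetP (sF j) _ xj; rewrite inE => /eqP <-.
  by congr (c _); apply: val_inj; rewrite -xe -xe'.
exists kappa; split => //.
  apply/subsetP => x; rewrite inE ffunE; case: pickP => // i xi _.
  exact: (subsetP (edge_class_sub c i)) (subsetP (sF i) _ xi).
apply/subsetP => x xG; apply/bigcupP; exists (c (exist _ x xG)) => //.
rewrite classE; have [_ sC] := FC _ (sP (c (exist _ x xG))); apply: (subsetP sC).
by apply/imsetP; exists (exist _ x xG); rewrite ?inE.
Qed.

Section Robustness.
Variables (R : realType) (r : nat) (V : finType) (H : sgraph V).
Hypotheses (hr : (2 <= r)%N) (hH : (2 <= maxdeg H)%N).

Let k := #|edges H|.
Let v := #|V|.

(** Positivity of [x] forces a copy of [H] to exist, which rules out the degenerate quotient by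
    0. *)
Lemma robustness_ge (n : nat) (G : sgraph 'I_n) (x y : R) : 0 < x -> 0 < y ->
    (forall c : {ffun {e : {set 'I_n} | e \in edges G} -> 'I_r},
       x <= #|mono_copies H c|%:R) ->
    mass (emb_weight H R) (edges G) <= y ->
  x / y <= robustness R r H G.
Proof.
move=> x0 y0 le_x le_y; have r0 : (0 < r)%N by apply: ltnW.
have le_mult : x <= (multiplicity r H G)%:R.
  rewrite /multiplicity; elim/big_ind: _ => // [|a b xa xb].
    by apply: le_trans (le_x [ffun=> Ordinal r0]) _; rewrite ler_nat card_mono_copies_le.
  by rewrite /minn; case: ifP.
have cle : (multiplicity 1 H G)%:R <= y.
  apply: le_trans le_y; rewrite mass_emb_weight multiplicity1 ler_nat; exact: card_copies_le.
have cgt : 0 < (multiplicity 1 H G)%:R :> R.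
  apply: lt_le_trans x0 (le_trans le_mult _); rewrite multiplicity1 ler_nat.
  exact: multiplicity_le.
rewrite /robustness ler_pdivlMr // mulrAC ler_pdivrMr //.
by apply: ler_pM => //; apply: ltW.
Qed.

Theorem robustness_probability :
  exists eta theta B : R, exists n0 : nat, [/\ 0 < eta, 0 < theta &
    forall (n : nat) (p : R), (n0 < n)%N -> 0 <= p <= 1 ->
    theta^-1 * n%:R `^ (- (1 / m2 R H)) <= p ->
    1 - B / n%:R <= Gnp_prob p (fun G : sgraph 'I_n => eta <= robustness R r H G)].
Proof.
have r0 : (0 < r)%N by apply: ltnW.
have [eps [delta [n0 [eps0 delta0 super]]]] := supersaturation R H r0.
set K := degree_const R H; have K1 : 1 <= K := degree_const_ge1 R hH.
have [alpha [c [q1 [alpha0 c0 q10 cont]]]] := sparse_containers k K1 eps0.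
have rr0 : 0 < r%:R :> R by rewrite ltr0n.
(* From exp(a) >= a follows r exp(-a) <= delta / 4; [theta] below ensures a r c theta <= delta / 4.
   Together they use up half of [delta]. *)
pose a := 4 * r%:R / delta.
have a0 : 0 < a by rewrite divr_gt0 // mulr_gt0.
(* The bound 1 gives q <= p, so that the degree bounds hold at both densities; [q1] is the limit set
   by the containers. *)
pose theta := Num.min 1 (Num.min q1 (delta / (4 * a * r%:R * c))).
have d4 : 0 < 4 * a * r%:R * c by do 3 apply: mulr_gt0 => //.
have th0 : 0 < theta by rewrite /theta !lt_min ltr01 q10 divr_gt0.
have th1 : theta <= 1 by rewrite /theta ge_min lexx.
have thq : theta <= q1 by rewrite /theta !ge_min lexx orbT.
have tha : theta * (4 * a * r%:R * c) <= delta.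
  by rewrite -ler_pdivlMr // /theta !ge_min lexx !orbT.
pose vv : R := #|V|%:R ^+ #|V|.
have vv0 : 0 < vv by rewrite exprn_gt0 // ltr0n (leq_trans _ (card_vertices_ge2 hH)).
(* [eta] is the sparseness level alpha q^k n^v, divided by [vv] to pass to copies and by the bound 2
   n^v p^k on all copies. [B] adds up the two failure probabilities. *)
exists (alpha * theta ^+ k / vv / 2), theta, (2 / delta + 2 ^+ k * K), n0.
split => //; first by rewrite !divr_gt0 // mulr_gt0 // exprn_gt0.
move=> n p ltn p01 le_p; have [p_ge0 p_le1] := andP p01.
have n_gt0 : (0 < n)%N by apply: leq_trans ltn.
pose x : R := n%:R; have x1 : 1 <= x by rewrite ler1n.
have x0 : 0 < x by apply: lt_le_trans x1.
pose q := theta * p.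
have le_q : x `^ (- (1 / m2 R H)) <= q by rewrite -ler_pdivrMl.
have pow0 : 0 < x `^ (- (1 / m2 R H)) by apply: powR_gt0.
have q0 : 0 < q by apply: lt_le_trans le_q.
have qp : q <= p by apply: ler_piMl.
have p0 : 0 < p by apply: lt_le_trans qp.
(* As m2 >= 1, the power of n is at least 1/n. This yields p n^2 >= n, so both error terms are
   O(1/n). *)
have qx : 1 <= q * x.
  have m1 : 1 <= m2 R H := m2_ge1 R hH.
  have m0 : 0 < m2 R H by apply: lt_le_trans m1.
  apply: (@le_trans _ _ (x `^ (- 1) * x)).
    by rewrite powR_inv1 ?mulVf ?gt_eqF // ltW.
  apply: ler_wpM2r; first exact: ltW.
  apply: le_trans le_q; apply: ler_powR => //.
  by rewrite lerN2 div1r invf_le1.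
have qN : 1 <= q * x ^+ 2 by rewrite expr2 mulrA; apply: mulr_ege1.
have px : x <= p * x ^+ 2.
  rewrite expr2 mulrA; apply: ler_peMl; first exact: ltW.
  by apply: le_trans qx _; apply: ler_wpM2r => //; apply: ltW.
pose M := x ^+ (v - 2).
have M0 : 0 < M by apply: exprn_gt0.
have MN : M * x ^+ 2 = x ^+ v by rewrite -exprD subnK // (card_vertices_ge2 hH).
have SN : #|pairs n|%:R <= x ^+ 2 by rewrite -natrX ler_nat card_pairs_le.
have deg_q (B : {set {set 'I_n}}) : B != set0 -> deg (emb_weight H R) B <= K * (q ^+ #|B|.-1 * M).
  exact: (deg_emb_weight_le hH n_gt0 le_q).
have deg_p (B : {set {set 'I_n}}) : B != set0 -> deg (emb_weight H R) B <= K * (p ^+ #|B|.-1 * M).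
  exact: (deg_emb_weight_le hH n_gt0 (le_trans le_q qp)).
have q_le1 : q <= q1.
  by apply: le_trans thq; rewrite -[leRHS]mulr1; apply: ler_wpM2l => //; apply: ltW.
have [F [C FC]] := cont _ (pairs n) (emb_weight H R) q M (x ^+ 2) q0 q_le1 M0 qN SN
  (@emb_weight_ge0 _ H n R) (@uniform_emb_weight _ H n R) deg_q.
pose W := mass (emb_weight H R) (pairs n).
have W0 : 0 <= W by apply: sumr_ge0 => A _; apply: emb_weight_ge0.
have Wx : W <= x ^+ v.
  rewrite /W mass_emb_weight -natrX ler_nat; apply: leq_trans (max_card _) _.
  by rewrite card_ffun card_ord.
pose y := x ^+ v * p ^+ k.
have y0 : 0 < y by rewrite mulr_gt0 // exprn_gt0.
pose bad1 (G : sgraph 'I_n) := [exists kappa : {ffun {set 'I_n} -> option 'I_r},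
      [&& #|coloured kappa|%:R <= r%:R * (c * (q * x ^+ 2)),
          delta * x ^+ 2 <= #|pairs n :\: covered C kappa|%:R,
          coloured kappa \subset pairs n & coloured kappa \subset covered C kappa] &&
      ((coloured kappa \subset edges G) && (edges G \subset covered C kappa))].
pose bad2 (G : sgraph 'I_n) := W * p ^+ k + y <= mass (emb_weight H R) (edges G).
have P1 : Gnp_prob p bad1 <= 2 / delta / x.
  apply: le_trans (fingerprint_union_bound p01 r C _ _ (ltW a0)) _.
  have ea : expR (- a) <= delta / (4 * r%:R).
    have -> : delta / (4 * r%:R) = a^-1.
      by rewrite /a; field; rewrite !gt_eqF.
    rewrite expRN lef_pV2 ?posrE ?expR_gt0 //.
    by apply: le_trans (expR_ge1Dx a); rewrite lerDr.
  have px0 : 0 < p * x ^+ 2 by rewrite mulr_gt0 // exprn_gt0.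
  apply: (@le_trans _ _ (expR (- (delta / 2 * (p * x ^+ 2))))).
    rewrite ler_expR.
    have h1 : a * (r%:R * (c * (q * x ^+ 2))) <= delta / 4 * (p * x ^+ 2).
      have -> : a * (r%:R * (c * (q * x ^+ 2))) = theta * (4 * a * r%:R * c) / 4 * (p * x ^+ 2).
        by rewrite /q; field.
      apply: ler_wpM2r; first exact: ltW.
      by rewrite ler_pM2r // invr_gt0.
    have h2 : r%:R * p * expR (- a) * #|pairs n|%:R <= delta / 4 * (p * x ^+ 2).
      apply: (@le_trans _ _ (r%:R * p * (delta / (4 * r%:R)) * x ^+ 2)).
        apply: ler_pM => //; first by rewrite !mulr_ge0 ?expR_ge0.
        by apply: ler_wpM2l => //; rewrite mulr_ge0.
      by rewrite le_eqVlt; apply/orP; left; apply/eqP; field; rewrite gt_eqF.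
    have -> : - (delta / 2 * (p * x ^+ 2)) =
        delta / 4 * (p * x ^+ 2) + delta / 4 * (p * x ^+ 2) - p * (delta * x ^+ 2) by field.
    by rewrite lerD2r lerD.
  (* The crude estimate exp(-y) <= 1/y is enough here. *)
  rewrite expRN -[2 / delta]invf_div -invfM lef_pV2 ?posrE ?expR_gt0 ?mulr_gt0 ?invr_gt0 //.
  apply: le_trans (expR_ge1Dx _).
  apply: (@le_trans _ _ (delta / 2 * (p * x ^+ 2))); first by rewrite ler_pM2l // divr_gt0.
  by rewrite lerDr.
have P2 : Gnp_prob p bad2 <= 2 ^+ k * K / x.
  apply: le_trans (mass_upper_tail p01 (@emb_weight_ge0 _ H n R) (@uniform_emb_weight _ H n R)
    (le_trans ler01 K1) (ltW M0) deg_p y0) _; rewrite -/W -/k.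
  rewrite ler_pdivrMr ?exprn_gt0 //.
  have kE : (2 * k).-1.+1 = (k + k)%N by rewrite prednK ?muln_gt0 ?card_edges_gt0 // mul2n addnn.
  have kk : 0 <= 2 ^+ k * K by rewrite mulr_ge0 ?exprn_ge0 // (le_trans _ K1).
  apply: (@le_trans _ _ (x ^+ v * (2 ^+ k * (K * (p ^+ (2 * k).-1 * M))))).
    apply: ler_wpM2r => //; rewrite mulrA mulr_ge0 // mulr_ge0 ?exprn_ge0 //; exact: ltW.
  have -> : y ^+ 2 = x ^+ v * (M * x ^+ 2) * (p * p ^+ (2 * k).-1).
    by rewrite -exprS kE exprD MN /y; move: (x ^+ v) (p ^+ k) => u1 u2; ring.
  have -> : 2 ^+ k * K / x * (x ^+ v * (M * x ^+ 2) * (p * p ^+ (2 * k).-1))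
     = x ^+ v * (2 ^+ k * (K * (p ^+ (2 * k).-1 * M))) * (p * x ^+ 2 / x).
    move: (p ^+ (2 * k).-1) (x ^+ v) (2 ^+ k) (K) (M) (x) x0 => u1 u2 u3 u4 u5 u6 u60.
    by field; rewrite gt_eqF.
  apply: ler_peMr; last by rewrite ler_pdivlMr // mul1r.
  apply: mulr_ge0; first by rewrite exprn_ge0 // ltW.
  by rewrite mulrA mulr_ge0 // mulr_ge0 ?exprn_ge0 // ltW.
rewrite Gnp_prob_compl // lerD2l lerN2 [leRHS]mulrDl.
apply: le_trans (lerD P1 P2); apply: le_trans (Gnp_prob_union p01 _ _).
apply: Gnp_prob_subset => // G; apply: contraR; rewrite negb_or => /andP[nbad1 nbad2].
have yE : alpha * theta ^+ k / vv / 2 = (alpha * (q ^+ k * (M * x ^+ 2)) / vv) / (2 * y).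
  rewrite MN /y /q exprMn; have : p ^+ k != 0 by rewrite expf_neq0 // gt_eqF.
  have : x ^+ v != 0 by rewrite expf_neq0 // gt_eqF.
  move: (theta ^+ k) (p ^+ k) (x ^+ v) (vv) vv0 => u1 u2 u3 u4 u40 u30 u20.
  by field; rewrite ?u30 ?u20 ?(gt_eqF u40).
rewrite yE; apply: robustness_ge.
- by rewrite divr_gt0 // !mulr_gt0 // !exprn_gt0.
- by rewrite mulr_gt0.
(* Too few monochromatic copies make every class sparse; the joint fingerprint of the classes is
   then a witness for [bad1]. *)
- move=> col; rewrite leNgt; apply: contra nbad1; rewrite ltr_pdivlMr // => few.
  have few_i i : mass (emb_weight H R) (edge_class col i) < alpha * (q ^+ k * (M * x ^+ 2)).
    apply: le_lt_trans few; rewrite mass_emb_weight mulrC /vv -natrX -natrM ler_nat.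
    exact: card_embeddings_class.
  have sP i : edge_class col i \subset pairs n.
    exact: subset_trans (edge_class_sub col i) (edges_sub_pairs G).
  have [|kappa [classE sG Gs]] := @colouring_fingerprint n r G col F C.
    by move=> I /FC[].
  apply/existsP; exists kappa; rewrite sG Gs (subset_trans sG (edges_sub_pairs G)).
  rewrite (subset_trans sG Gs) !andbT; apply/andP; split.
    apply: (@le_trans _ _ (\sum_(i < r) c * (q * x ^+ 2))); last first.
      by rewrite sumr_const card_ord -[leLHS]mulr_natl.
    apply: (@le_trans _ _ (\sum_(i < r) #|colour_class kappa i|)%:R).
      rewrite ler_nat; apply: leq_card_family_cover => e; rewrite inE.
      by case E: (kappa e) => [i|//] _; exists i; rewrite ?inE ?E.
    rewrite natr_sum; apply: ler_sum => i _; rewrite classE.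
    by case: (FC _ (sP i)).
  apply: super; first exact: ltnW.
  move=> i; rewrite classE -MN; case: (FC _ (sP i)) => _ _ _; apply; exact: few_i.
- apply: ltW; move: nbad2; rewrite /bad2 -ltNge => /lt_le_trans; apply.
  have -> : 2 * y = y + y by ring.
  by rewrite lerD2r; apply: ler_wpM2r; rewrite ?exprn_ge0.
Qed.

End Robustness.

From mathcomp Require Import all_classical all_reals all_analysis.
Import numFieldNormedType.Exports.
Local Open Scope classical_set_scope.

Theorem theorem4p4 (R : realType) (r : nat) (hr : (2 <= r)%N)
    (V : finType) (H : sgraph V) (hH : (2 <= maxdeg H)%N) :
  exists eta C : R, 0 < eta /\
    forall p : nat -> R,
      (forall n : nat, 0 <= p n <= 1) ->
      (\forall n \near \oo, C * n%:R `^ (- (1 / m2 R H)) <= p n) ->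
      (fun n : nat => Gnp_prob (p n)
         (fun G : sgraph 'I_n => eta <= robustness R r H G)) @ \oo --> (1 : R).
Proof.
have [eta [theta [B [n0 [eta0 th0 bound]]]]] := robustness_probability R hr hH.
exists eta, theta^-1; split=> // p p01 le_p.
have lower : (fun n : nat => 1 - B / n%:R) @ \oo --> (1 : R).
  rewrite -[X in _ --> X]subr0 -[X in _ --> _ - X](mulr0 B).
  apply: cvgB; first exact: cvg_cst.
  apply: cvgM; first exact: cvg_cst.
  (* The harmonic sequence is 1/(n+1), hence the shift. *)
  rewrite -(cvg_shiftS (fun n : nat => n%:R^-1 : R)); exact: cvg_harmonic.
apply: (@squeeze_cvgr _ _ _ _ (fun n : nat => 1 - B / n%:R) (fun=> 1)) => //; last exact: cvg_cst.
near=> n; apply/andP; split; last exact: Gnp_prob_le1.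
apply: bound => //; last by near: n.
by near: n; exists n0.+1.
Unshelve. all: by end_near.
Qed.
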